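(* There exist universal constants $C,C'>0$ such that the following holds. Let $P$ be an irreducible, aperiodic transition matrix on a finite set $G$ with $|G|\ge2$, reversible with respect to the probability measure $\pi$. Then for every nonempty $S\subset G$ and every $x\in S$, $$h_S(x)\le \frac{C}{u(P)(1-\lambda)}\,\pi(x)\Big(\log(2e/\pi_{\min})\vee \pi(S)^{-1}\Big)\le \frac{C'\pi_{\max}}{(1-\lambda)^2\pi_{\min}}\,\pi(x)\Big(\log(2e/\pi_{\min})\vee\pi(S)^{-1}\Big).$$ In particular, for simple random walk on a finite connected regular graph $G$ with $N=|G|\ge2$ vertices (with $1-\lambda$ the spectral gap of its lazy version if the walk is periodic), $$h_S(x)\le \frac{C}{u(P)(1-\lambda)}\Big(\frac1{|S|}\vee\frac{\log N}{N}\Big)\le\frac{C'}{(1-\lambda)^2}\Big(\frac1{|S|}\vee\frac{\log N}{N}\Big).$$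
   Context: $(X_t)$ is the chain with transition matrix $P$. $\lambda=\max_{j>1}|\lambda_j|$, where $1=\lambda_1>\lambda_2\ge\dots\ge\lambda_n>-1$ are the eigenvalues of $P$. $\pi_{\min}=\min_x\pi(x)$, $\pi_{\max}=\max_x\pi(x)$, and $a\vee b=\max\{a,b\}$. For $A\subset G$, $T_A=\inf\{t\ge0:X_t\in A\}$ and $T_A^+=\inf\{t\ge1:X_t\in A\}$. $u(P):=\min_{x\ne y}\Pr_x[T_y<T_x^+]$. The harmonic measure on $S$ from $y$ is $h_{y,S}(x)=\Pr_y[X_{T_S}=x]$, and $h_S(x)=\sum_y\pi(y)h_{y,S}(x)$ is the harmonic measure from stationarity. Harmonic measure is unchanged when $P$ is replaced by the lazy chain $\frac12(I+P)$, which changes the spectral gap by at most a factor of $2$. *)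

(* Defs.v *)
From Stdlib Require Import Reals Lra Lia Arith List ClassicalEpsilon.
Open Scope R_scope.

(* States of a chain on n states are 0, ..., n-1.  Kernels are nat -> nat -> R;
   only values on indices < n matter. *)

Definition rsum (n : nat) (f : nat -> R) : R := fold_right Rplus 0 (map f (seq 0 n)).

Fixpoint mpow (n : nat) (P : nat -> nat -> R) (t : nat) : nat -> nat -> R :=
  match t with
  | O => fun i j => if Nat.eqb i j then 1 else 0
  | S t' => fun i j => rsum n (fun k => P i k * mpow n P t' k j)
  end.

Definition stochastic (n : nat) (P : nat -> nat -> R) : Prop :=
  (forall i j, (i < n)%nat -> (j < n)%nat -> 0 <= P i j) /\
  (forall i, (i < n)%nat -> rsum n (P i) = 1).

Definition prob_measure (n : nat) (pi : nat -> R) : Prop :=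
  (forall i, (i < n)%nat -> 0 <= pi i) /\ rsum n pi = 1.

Definition reversible (n : nat) (P : nat -> nat -> R) (pi : nat -> R) : Prop :=
  forall i j, (i < n)%nat -> (j < n)%nat -> pi i * P i j = pi j * P j i.

Definition irreducible (n : nat) (P : nat -> nat -> R) : Prop :=
  forall i j, (i < n)%nat -> (j < n)%nat -> exists t, 0 < mpow n P t i j.

Definition aperiodic (n : nat) (P : nat -> nat -> R) : Prop :=
  forall i, (i < n)%nat -> forall d, (1 <= d)%nat ->
    (forall t, (1 <= t)%nat -> 0 < mpow n P t i i -> Nat.modulo t d = 0%nat) ->
    d = 1%nat.

(* limit of a real sequence (chosen by classical epsilon; it is THE limit
   whenever the sequence converges) *)
Definition lim_seq (u : nat -> R) : R :=
  epsilon (inhabits 0) (fun l => Un_cv u l).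

(* hit_fin n P A x t y = Pr_y[ T_A <= t and X_{T_A} = x ],
   with T_A = inf { t >= 0 : X_t in A } *)
Fixpoint hit_fin (n : nat) (P : nat -> nat -> R) (A : nat -> bool) (x : nat)
  (t : nat) (y : nat) {struct t} : R :=
  if A y then (if Nat.eqb y x then 1 else 0)
  else match t with
       | O => 0
       | S t' => rsum n (fun z => P y z * hit_fin n P A x t' z)
       end.

Definition hmeas (n : nat) (P : nat -> nat -> R) (A : nat -> bool) (y x : nat) : R :=
  lim_seq (fun t => hit_fin n P A x t y).

Definition hstat (n : nat) (P : nat -> nat -> R) (pi : nat -> R) (A : nat -> bool) (x : nat) : R :=
  rsum n (fun y => pi y * hmeas n P A y x).

(* avoid_fin n P x y t z = Pr_z[ T_y < T_x and T_y <= t ] (hitting times >= 0) *)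
Fixpoint avoid_fin (n : nat) (P : nat -> nat -> R) (x y : nat) (t : nat) (z : nat)
  {struct t} : R :=
  if Nat.eqb z y then 1
  else if Nat.eqb z x then 0
  else match t with
       | O => 0
       | S t' => rsum n (fun w => P z w * avoid_fin n P x y t' w)
       end.

(* Pr_x[ T_y < T_x^+ ]  (the finite-horizon version at time t is
   Pr_x[T_y < T_x^+, T_y <= t+1]) *)
Definition escape (n : nat) (P : nat -> nat -> R) (x y : nat) : R :=
  lim_seq (fun t => rsum n (fun z => P x z * avoid_fin n P x y t z)).

(* u(P) = min_{x <> y} Pr_x[T_y < T_x^+]  (for n >= 2) *)
Definition offdiag_pairs (n : nat) : list (nat * nat) :=
  flat_map (fun i => map (fun j => (i, j)) (filter (fun j => negb (Nat.eqb i j)) (seq 0 n)))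
           (seq 0 n).

Definition uP (n : nat) (P : nat -> nat -> R) : R :=
  fold_right Rmin (escape n P 0 1)
    (map (fun p => escape n P (fst p) (snd p)) (offdiag_pairs n)).

(* A spectral decomposition: f j (j < n) are n linearly independent
   (real) eigenvectors of P with eigenvalues lam j, listed so that
   lam 0 >= lam 1 >= ... >= lam (n-1).  Thus lam 0, ..., lam (n-1) are the
   eigenvalues of P with multiplicity, in decreasing order. *)
Definition spectral_decomp (n : nat) (P : nat -> nat -> R)
  (lam : nat -> R) (f : nat -> nat -> R) : Prop :=
  (forall j i, (j < n)%nat -> (i < n)%nat ->
     rsum n (fun k => P i k * f j k) = lam j * f j i) /\
  (forall c : nat -> R,
     (forall i, (i < n)%nat -> rsum n (fun j => c j * f j i) = 0) ->
     forall j, (j < n)%nat -> c j = 0) /\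
  (forall j, (S j < n)%nat -> lam (S j) <= lam j).

(* max_{j > 1} |lambda_j| (indices shifted to start at 0) *)
Definition slem_of (n : nat) (lam : nat -> R) : R :=
  fold_right Rmax 0 (map (fun j => Rabs (lam j)) (seq 1 (n - 1))).

Definition slem (n : nat) (P : nat -> nat -> R) : R :=
  epsilon (inhabits 0)
    (fun l => exists lam f, spectral_decomp n P lam f /\ l = slem_of n lam).

Definition pi_min (n : nat) (pi : nat -> R) : R := fold_right Rmin (pi 0%nat) (map pi (seq 0 n)).
Definition pi_max (n : nat) (pi : nat -> R) : R := fold_right Rmax (pi 0%nat) (map pi (seq 0 n)).

Definition pi_set (n : nat) (pi : nat -> R) (A : nat -> bool) : R :=
  rsum n (fun i => if A i then pi i else 0).

Definition card_set (n : nat) (A : nat -> bool) : nat := length (filter A (seq 0 n)).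

Inductive reach (adj : nat -> nat -> bool) : nat -> nat -> Prop :=
  | reach_refl : forall x, reach adj x x
  | reach_step : forall x y z, adj x y = true -> reach adj y z -> reach adj x z.

Definition simple_graph (N : nat) (adj : nat -> nat -> bool) : Prop :=
  (forall x y, (x < N)%nat -> (y < N)%nat -> adj x y = adj y x) /\
  (forall x, (x < N)%nat -> adj x x = false) /\
  (forall x y, adj x y = true -> (x < N)%nat /\ (y < N)%nat).

Definition connected (N : nat) (adj : nat -> nat -> bool) : Prop :=
  forall x y, (x < N)%nat -> (y < N)%nat -> reach adj x y.

Definition degree (N : nat) (adj : nat -> nat -> bool) (x : nat) : nat :=
  length (filter (adj x) (seq 0 N)).

Definition regular (N : nat) (adj : nat -> nat -> bool) (d : nat) : Prop :=
  forall x, (x < N)%nat -> degree N adj x = d.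

Definition srw (adj : nat -> nat -> bool) (d : nat) : nat -> nat -> R :=
  fun x y => if adj x y then / INR d else 0.

Definition lazy (P : nat -> nat -> R) : nat -> nat -> R :=
  fun x y => ((if Nat.eqb x y then 1 else 0) + P x y) / 2.

Definition uniform (N : nat) : nat -> R := fun _ => / INR N.

(* Main.v *)
(** Pairing the harmonic measure [h] of [x] with [(I - P) g], where [g y] is the mean hitting time
of [S] from [y], gives [h_S x = pi x * (1 + P g x)], that is [pi x] times the mean return time to
[S].  Everything then follows from the Poincare inequality with constant [gam = 1 - lambda].

Since [g] vanishes on [S], [pi S * (mean g)^2 <= Var g <= mean g / gam], which bounds both the mean
and the variance of [g].  Since [g <= 1 + P g], iterating the lazy kernel [L] gives
[g <= t / 2 + L^t g]; as [L] contracts the variance by [1 - gam / 2], a time [t] of order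
[log (1 / pi_min) / gam] makes [L^t g] pointwise at most [mean g + 1 / (gam * pi S)].  So
[h_S x] is at most a constant times [pi x / gam] times the maximum of the theorem, and the factor
[1 / u] is at least [1].

For the second bound, [pi x * Pr_x (T_y < T_x^+)] is the Dirichlet energy of the potential equal
to [0] at [x] and [1] at [y], hence at least [gam] times its variance, so that
[u >= gam * pi_min / (2 * pi_max)].  In the periodic case the Poincare inequality of the lazy walk
implies that of the walk with the same constant. *)

From mathcomp Require all_boot all_order all_fingroup all_algebra.
From mathcomp Require Rstruct complex.
Require Import Defs.
From Stdlib Require Import Reals ClassicalEpsilon.
From Stdlib Require Import Lra Lia Arith ZArith List.
Open Scope R_scope.

(** * Diagonalization of real symmetric matrices *)

Module Spectral.
Import all_boot all_order all_fingroup all_algebra Rstruct complex.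
Import Order.TTheory GRing.Theory Num.Theory.
Local Open Scope ring_scope.
Set Implicit Arguments.
Unset Strict Implicit.
Unset Printing Implicit Defensive.

(** Over [R[i]] the matrix is hermitian, hence unitarily diagonalizable with real spectrum. The rows
    of [V] are left eigenvectors of [A]. *)
Lemma symmetric_diagonalizable (R : rcfType) (n : nat) (A : 'M[R]_n) :
  A^T = A ->
  exists (V : 'M[R]_n) (D : 'rV[R]_n),
    V \in unitmx /\ V *m A = diag_mx D *m V.
Proof.
move=> symA; set toC := real_complex R.
set AC := map_mx toC A.
have realAC : AC \is a realmx.
  by apply/mxOverP => i j; rewrite mxE; apply/complex_realP; exists (A i j).
have symAC : AC \is symmetricmx.
  apply/is_hermitianmxP; rewrite expr0 scale1r map_mx_id //.
  by apply/matrixP => i j; rewrite !mxE -[in LHS]symA mxE.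
have hermAC := realsym_hermsym symAC realAC.
have /orthomx_spectralP eqAC := hermitian_normalmx hermAC.
have unitP := spectral_unit AC.
have simAC : similar_in unitmx AC (diag_mx (spectral_diag AC)).
  exists (spectralmx AC) => //; apply/similarP => //.
  by rewrite [X in _ *m X = _]eqAC !mulmxA mulmxV // mul1mx.
have realD := hermitian_spectral_diag_real hermAC.
have realDD : diag_mx (spectral_diag AC) \is a realmx.
  apply/mxOverP => i j; rewrite mxE; case: eqP => _; last by rewrite mulr0n.
  by rewrite mulr1n; apply: (mxOverP realD).
(* Two real matrices that are similar over [R[i]] are similar through a real [Q], which then
   descends to [R] by taking real parts. *)
have [Q /andP[realQ unitQ] /(similarP unitQ) eqQ] := real_similar simAC realAC realDD.
have reK (m p : nat) (M : 'M[R[i]]_(m, p)) :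
    M \is a realmx -> map_mx toC (map_mx (@complex.Re R) M) = M.
  by move=> realM; apply/matrixP => i j; rewrite !mxE /toC RRe_real // (mxOverP realM).
exists (map_mx (@complex.Re R) Q), (map_mx (@complex.Re R) (spectral_diag AC)).
split; first by rewrite -(map_unitmx toC) reK.
apply: (@map_mx_inj _ _ toC).
by rewrite !map_mxM map_diag_mx !reK.
Qed.

Lemma rsumE n F : rsum n F = \sum_(i < n) F (val i).
Proof.
rewrite -(big_mkord xpredT) /rsum /index_iota subn0.
have -> : List.seq 0 n = iota 0 n by elim: n 0%N => //= n IH m; rewrite IH.
by elim: (iota 0 n) => [|i s IH] /=; rewrite ?big_nil ?big_cons -?IH.
Qed.

(** Independence makes the square matrix [M] with rows [f j] invertible, and the coordinates of [g]
    are [g *m invmx M]. *)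
Lemma independent_span (n : nat) (f : nat -> nat -> Rdefinitions.R) :
  (forall c : nat -> Rdefinitions.R,
     (forall i, (i < n)%coq_nat -> rsum n (fun j => Rmult (c j) (f j i)) = 0) ->
     forall j, (j < n)%coq_nat -> c j = 0) ->
  forall g : nat -> Rdefinitions.R, exists c : nat -> Rdefinitions.R,
    forall i, (i < n)%coq_nat -> g i = rsum n (fun j => Rmult (c j) (f j i)).
Proof.
move=> indep g; pose M : 'M[Rdefinitions.R]_n := \matrix_(j, i) f j i.
pose coef (v : 'rV[Rdefinitions.R]_n) j := if insub j is Some o then v 0 o else 0.
have coefE v (i : 'I_n) : rsum n (fun j => Rmult (coef v j) (f j i)) = (v *m M) 0 i.
  by rewrite rsumE mxE; apply: eq_bigr => j _; rewrite /coef valK mxE.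
have unitM : M \in unitmx.
  rewrite -row_free_unit; apply: inj_row_free => v vM0.
  apply/rowP => j; rewrite mxE.
  have <- : coef v j = v 0 j by rewrite /coef valK.
  apply: indep; last exact/ssrnat.ltP.
  by move=> i /ssrnat.ltP lt_in; rewrite (coefE v (Ordinal lt_in)) vM0 mxE.
exists (coef (\row_i g i *m invmx M)) => i /ssrnat.ltP lt_in.
by rewrite (coefE _ (Ordinal lt_in)) mulmxKV // mxE.
Qed.

(** Symmetry of [S] turns the left eigenvectors in the rows of [V] into right ones. Sorting the
    eigenvalues permutes these rows, which preserves independence. *)
Lemma symmetric_spectral_decomp (n : nat) (S : nat -> nat -> Rdefinitions.R) :
  (forall i j, (i < n)%coq_nat -> (j < n)%coq_nat -> S i j = S j i) ->
  exists lam f, spectral_decomp n S lam f.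
Proof.
move=> symS; case: n symS => [|n] symS.
  by exists (fun _ => 0), (fun _ _ => 0);
  split=> [j i /ssrnat.ltP //|]; split=> [c _ j /ssrnat.ltP //|j /ssrnat.ltP].
pose A : 'M[Rdefinitions.R]_n.+1 := \matrix_(i, j) S i j.
have [|V [D [unitV VA]]] := @symmetric_diagonalizable _ _ A.
  by apply/matrixP => i j; rewrite !mxE; apply: symS; apply/ssrnat.ltP.
pose r := [rel i j : 'I_n.+1 | D 0 j <= D 0 i].
pose s := sort r (enum 'I_n.+1).
have size_s : size s = n.+1 by rewrite size_sort size_enum_ord.
have sorted_s : sorted r s by apply: sort_sorted => i j; apply: le_total.
pose sg (k : 'I_n.+1) := nth ord0 s k.
have sg_inj : injective sg.
  move=> i j /eqP; rewrite nth_uniq ?size_s ?sort_uniq ?enum_uniq // => /eqP.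
  exact: val_inj.
pose W := row_perm (perm sg_inj) V.
have unitW : W \in unitmx by rewrite /W row_permE unitmx_mul unitmx_perm.
exists (fun k => D 0 (nth ord0 s k)), (fun k i => V (nth ord0 s k) (inord i)).
split; last split.
- move=> j i /ssrnat.ltP lt_j /ssrnat.ltP lt_i; move: VA => /matrixP/(_ (nth ord0 s j) (inord i)).
  rewrite mul_diag_mx !mxE => VAij; apply: etrans VAij; rewrite rsumE; apply: eq_bigr => k _.
  rewrite !mxE inordK // inord_val mulrC; congr (_ * _).
  by apply: symS; apply/ssrnat.ltP; rewrite ?ltn_ord.
- move=> c c0 j /ssrnat.ltP lt_j.
  have cW : (\row_k c (val k)) *m W = 0.
    apply/rowP => i; rewrite !mxE -[RHS](c0 i); last exact/ssrnat.ltP.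
    by rewrite rsumE; apply: eq_bigr => k _; rewrite !mxE permE inord_val.
  have /rowP/(_ (Ordinal lt_j)) : \row_k c (val k) = 0 :> 'rV_n.+1.
    by rewrite -[LHS](mulmxK unitW) cW mul0mx.
  by rewrite !mxE.
- move=> j /ssrnat.ltP lt_j; apply/RleP.
  by have /(sortedP ord0)/(_ j) := sorted_s; rewrite size_s => /(_ lt_j).
Qed.
End Spectral.

(** * Finite sums and limits *)

Lemma rsum_S (n : nat) (f : nat -> R) : rsum (S n) f = rsum n f + f n.
Proof.
  unfold rsum. rewrite seq_S, map_app, fold_right_app. simpl.
  generalize (map f (seq 0 n)). intros l.
  induction l as [|a l IH]; simpl; [lra|]. rewrite IH. lra.
Qed.

Lemma rsum_ext (n : nat) (f g : nat -> R) :
  (forall i, (i < n)%nat -> f i = g i) -> rsum n f = rsum n g.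
Proof.
  induction n as [|n IH]; intros H; [reflexivity|].
  rewrite !rsum_S, IH, H by auto. reflexivity.
Qed.

Lemma rsum_le (n : nat) (f g : nat -> R) :
  (forall i, (i < n)%nat -> f i <= g i) -> rsum n f <= rsum n g.
Proof.
  induction n as [|n IH]; intros H; [apply Rle_refl|].
  rewrite !rsum_S. apply Rplus_le_compat; auto.
Qed.

Lemma rsum_plus (n : nat) (f g : nat -> R) :
  rsum n (fun i => f i + g i) = rsum n f + rsum n g.
Proof.
  induction n as [|n IH]; [unfold rsum; simpl; lra|].
  rewrite !rsum_S, IH. lra.
Qed.

Lemma rsum_scal (n : nat) (c : R) (f : nat -> R) :
  rsum n (fun i => c * f i) = c * rsum n f.
Proof.
  induction n as [|n IH]; [unfold rsum; simpl; lra|].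
  rewrite !rsum_S, IH. lra.
Qed.

Lemma rsum_0 (n : nat) : rsum n (fun _ => 0) = 0.
Proof. induction n as [|n IH]; [reflexivity|]. rewrite rsum_S, IH. lra. Qed.

Lemma rsum_const (n : nat) (c : R) : rsum n (fun _ => c) = INR n * c.
Proof.
  induction n as [|n IH]; [unfold rsum; simpl; lra|].
  rewrite rsum_S, IH, S_INR. lra.
Qed.

Lemma rsum_nonneg (n : nat) (f : nat -> R) :
  (forall i, (i < n)%nat -> 0 <= f i) -> 0 <= rsum n f.
Proof. intros H. rewrite <- (rsum_0 n). apply rsum_le, H. Qed.

Lemma rsum_swap (n m : nat) (f : nat -> nat -> R) :
  rsum n (fun i => rsum m (fun j => f i j)) = rsum m (fun j => rsum n (fun i => f i j)).
Proof.
  induction n as [|n IH].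
  - symmetry. apply (rsum_0 m).
  - rewrite rsum_S, IH, <- rsum_plus. apply rsum_ext. intros j _. now rewrite rsum_S.
Qed.

Lemma rsum_delta (n k : nat) (f : nat -> R) :
  (k < n)%nat -> rsum n (fun i => if Nat.eqb i k then f i else 0) = f k.
Proof.
  induction n as [|n IH]; intros Hk; [lia|]. rewrite rsum_S.
  destruct (Nat.eq_dec n k) as [->|Hnk].
  - rewrite Nat.eqb_refl. rewrite (rsum_ext k _ (fun _ => 0)), rsum_0; [lra|].
    intros i Hi. destruct (Nat.eqb_spec i k); [lia|reflexivity].
  - rewrite IH by lia. destruct (Nat.eqb_spec n k); [lia|lra].
Qed.

Lemma rsum_ge_term (n k : nat) (f : nat -> R) :
  (forall i, (i < n)%nat -> 0 <= f i) -> (k < n)%nat -> f k <= rsum n f.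
Proof.
  intros Hf Hk. rewrite <- (rsum_delta n k f Hk). apply rsum_le.
  intros i Hi. destruct (Nat.eqb i k); [apply Rle_refl|auto].
Qed.

Lemma rsum_ge_two_terms (n k l : nat) (f : nat -> R) :
  (forall i, (i < n)%nat -> 0 <= f i) -> (k < n)%nat -> (l < n)%nat -> k <> l ->
  f k + f l <= rsum n f.
Proof.
  intros Hf Hk Hl Hkl.
  rewrite <- (rsum_delta n k f Hk), <- (rsum_delta n l f Hl), <- rsum_plus.
  apply rsum_le. intros i Hi.
  destruct (Nat.eqb_spec i k), (Nat.eqb_spec i l); subst; try lia;
    specialize (Hf _ Hi); lra.
Qed.

Lemma rsum_eq_0_term (n k : nat) (f : nat -> R) :
  (forall i, (i < n)%nat -> 0 <= f i) -> rsum n f <= 0 -> (k < n)%nat -> f k = 0.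
Proof.
  intros Hf H0 Hk. pose proof (rsum_ge_term n k f Hf Hk). specialize (Hf k Hk). lra.
Qed.

Lemma rsum_pos_term (n : nat) (f : nat -> R) :
  0 < rsum n f -> exists k, (k < n)%nat /\ 0 < f k.
Proof.
  induction n as [|n IH]; [unfold rsum; simpl; lra|]. rewrite rsum_S. intros H.
  destruct (Rlt_dec 0 (f n)) as [Hn|Hn].
  - exists n. split; [lia|assumption].
  - destruct IH as [k [Hk Hfk]]; [lra|]. exists k. split; [lia|assumption].
Qed.

Lemma rsum_cv (n : nat) (u : nat -> nat -> R) (l : nat -> R) :
  (forall i, (i < n)%nat -> Un_cv (fun t => u t i) (l i)) ->
  Un_cv (fun t => rsum n (u t)) (rsum n l).
Proof.
  induction n as [|n IH]; intros H.
  - intros eps Heps. exists 0%nat. intros t _. unfold rsum; simpl.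
    rewrite Rdist_eq. assumption.
  - rewrite rsum_S. intros eps Heps.
    destruct (CV_plus _ _ _ _ (IH (fun i Hi => H i (Nat.lt_lt_succ_r _ _ Hi)))
                (H n (Nat.lt_succ_diag_r n)) eps Heps) as [N HN].
    exists N. intros t Ht. rewrite rsum_S. apply HN, Ht.
Qed.

(** * Limits of sequences *)

Lemma const_cv (c : R) : Un_cv (fun _ => c) c.
Proof. intros eps Heps. exists 0%nat. intros t _. rewrite Rdist_eq. assumption. Qed.

Lemma cv_succ (u : nat -> R) (l : R) : Un_cv u l -> Un_cv (fun t => u (S t)) l.
Proof.
  intros H eps Heps. destruct (H eps Heps) as [N HN]. exists N.
  intros t Ht. apply HN. lia.
Qed.

Lemma cv_le_bound (u : nat -> R) (l b : R) : Un_cv u l -> (forall t, u t <= b) -> l <= b.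
Proof.
  intros Hu Hb. apply (@Rle_cv_lim u (fun _ => b)); [exact Hb|exact Hu|apply const_cv].
Qed.

Lemma cv_ge_bound (u : nat -> R) (l b : R) : Un_cv u l -> (forall t, b <= u t) -> b <= l.
Proof.
  intros Hu Hb. apply (@Rle_cv_lim (fun _ => b) u); [exact Hb|apply const_cv|exact Hu].
Qed.

Lemma lim_seq_eq (u : nat -> R) (l : R) : Un_cv u l -> lim_seq u = l.
Proof.
  intros Hu. apply (UL_sequence u); [|exact Hu].
  unfold lim_seq. apply epsilon_spec. now exists l.
Qed.

Lemma growing_lim_seq (u : nat -> R) (b : R) :
  Un_growing u -> (forall t, u t <= b) -> Un_cv u (lim_seq u).
Proof.
  intros Hg Hb. unfold lim_seq. apply epsilon_spec.
  destruct (growing_cv u Hg) as [l Hl]; [|now exists l].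
  exists b. intros r [t ->]. apply Hb.
Qed.

(** * Reversible chains satisfying a Poincare inequality *)

Definition op (n : nat) (P : nat -> nat -> R) (f : nat -> R) (i : nat) : R :=
  rsum n (fun j => P i j * f j).

Definition mean (n : nat) (pi f : nat -> R) : R := rsum n (fun i => pi i * f i).

Definition variance (n : nat) (pi f : nat -> R) : R :=
  mean n pi (fun i => (f i - mean n pi f) ^ 2).

Definition dirichlet (n : nat) (P : nat -> nat -> R) (pi f : nat -> R) : R :=
  mean n pi (fun i => f i * (f i - op n P f i)).

(** For a reversible kernel this says that the spectral gap is at least [gam], without naming
    eigenvalues. It puts no constraint on eigenvalues near -1, so periodic chains can satisfy it. *)
Definition poincare (n : nat) (P : nat -> nat -> R) (pi : nat -> R) (gam : R) : Prop :=
  forall f, gam * variance n pi f <= dirichlet n P pi f.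

(** * Linearity and self-adjointness of the kernel *)

Section Linear.
Context (n : nat) (P : nat -> nat -> R) (pi : nat -> R).

Lemma op_ext (f g : nat -> R) (i : nat) :
  (forall j, (j < n)%nat -> f j = g j) -> op n P f i = op n P g i.
Proof. intros H. apply rsum_ext. intros j Hj. now rewrite H. Qed.

Lemma mean_ext (f g : nat -> R) :
  (forall j, (j < n)%nat -> f j = g j) -> mean n pi f = mean n pi g.
Proof. intros H. apply rsum_ext. intros j Hj. now rewrite H. Qed.

Lemma op_lin (a b : R) (f g : nat -> R) (i : nat) :
  op n P (fun j => a * f j + b * g j) i = a * op n P f i + b * op n P g i.
Proof.
  unfold op. rewrite <- !rsum_scal, <- rsum_plus. apply rsum_ext. intros j _. ring.
Qed.

Lemma mean_lin (a b : R) (f g : nat -> R) :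
  mean n pi (fun j => a * f j + b * g j) = a * mean n pi f + b * mean n pi g.
Proof.
  unfold mean. rewrite <- !rsum_scal, <- rsum_plus. apply rsum_ext. intros j _. ring.
Qed.

Lemma op_rsum (m : nat) (c : nat -> R) (f : nat -> nat -> R) (i : nat) :
  op n P (fun k => rsum m (fun j => c j * f j k)) i
  = rsum m (fun j => c j * op n P (f j) i).
Proof.
  unfold op.
  rewrite (rsum_ext n _ (fun k => rsum m (fun j => P i k * (c j * f j k)))).
  2:{ intros k _. now rewrite rsum_scal. }
  rewrite rsum_swap. apply rsum_ext. intros j _. rewrite <- rsum_scal.
  apply rsum_ext. intros k _. ring.
Qed.

Lemma mean_rsum (m : nat) (c : nat -> R) (f : nat -> nat -> R) :
  mean n pi (fun k => rsum m (fun j => c j * f j k))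
  = rsum m (fun j => c j * mean n pi (f j)).
Proof.
  unfold mean.
  rewrite (rsum_ext n _ (fun k => rsum m (fun j => pi k * (c j * f j k)))).
  2:{ intros k _. now rewrite rsum_scal. }
  rewrite rsum_swap. apply rsum_ext. intros j _. rewrite <- rsum_scal.
  apply rsum_ext. intros k _. ring.
Qed.

Lemma op_selfadjoint (f g : nat -> R) :
  reversible n P pi ->
  mean n pi (fun i => g i * op n P f i) = mean n pi (fun i => f i * op n P g i).
Proof.
  intros Hrev. unfold mean, op.
  rewrite (rsum_ext n _ (fun i => rsum n (fun j => pi i * g i * (P i j * f j)))).
  2:{ intros i _. rewrite rsum_scal. ring. }
  rewrite rsum_swap. apply rsum_ext. intros j Hj.
  rewrite <- rsum_scal, <- rsum_scal. apply rsum_ext. intros i Hi.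
  transitivity (pi i * P i j * (f j * g i)); [ring|].
  rewrite (Hrev i j Hi Hj). ring.
Qed.

Lemma mean_le (f g : nat -> R) :
  (forall i, (i < n)%nat -> 0 <= pi i) ->
  (forall i, (i < n)%nat -> f i <= g i) -> mean n pi f <= mean n pi g.
Proof.
  intros Hp H. apply rsum_le. intros i Hi. apply Rmult_le_compat_l; auto.
Qed.

Lemma mean_nonneg (f : nat -> R) :
  (forall i, (i < n)%nat -> 0 <= pi i) ->
  (forall i, (i < n)%nat -> 0 <= f i) -> 0 <= mean n pi f.
Proof. intros Hp H. apply rsum_nonneg. intros i Hi. apply Rmult_le_pos; auto. Qed.

Lemma mean_delta (k : nat) (f : nat -> R) :
  (k < n)%nat -> mean n pi (fun i => if Nat.eqb i k then f i else 0) = pi k * f k.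
Proof.
  intros Hk. rewrite <- (rsum_delta n k (fun i => pi i * f i) Hk).
  apply rsum_ext. intros i _. destruct (Nat.eqb i k); ring.
Qed.
End Linear.

(** * Stationarity, variance and the Dirichlet form *)

Section Chain.
Context (n : nat) (P : nat -> nat -> R) (pi : nat -> R).
Context (Hsto : stochastic n P) (Hpi : prob_measure n pi) (Hrev : reversible n P pi).

Lemma mean_const (c : R) : mean n pi (fun _ => c) = c.
Proof.
  unfold mean. rewrite (rsum_ext n _ (fun i => c * pi i)) by (intros; ring).
  rewrite rsum_scal, (proj2 Hpi). ring.
Qed.

Lemma op_const (c : R) (i : nat) : (i < n)%nat -> op n P (fun _ => c) i = c.
Proof.
  intros Hi. unfold op. rewrite (rsum_ext n _ (fun j => c * P i j)) by (intros; ring).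
  rewrite rsum_scal, (proj2 Hsto) by assumption. ring.
Qed.

Lemma op_le (f g : nat -> R) (i : nat) :
  (i < n)%nat -> (forall j, (j < n)%nat -> f j <= g j) -> op n P f i <= op n P g i.
Proof.
  intros Hi H. apply rsum_le. intros j Hj. apply Rmult_le_compat_l; [|auto].
  now apply (proj1 Hsto).
Qed.

Lemma op_shift (c : R) (f : nat -> R) (i : nat) :
  (i < n)%nat -> op n P (fun j => c + f j) i = c + op n P f i.
Proof.
  intros Hi. rewrite (op_ext n P _ (fun j => c * 1 + 1 * f j)) by (intros; ring).
  rewrite op_lin, op_const by assumption. ring.
Qed.

Lemma mean_op (f : nat -> R) : mean n pi (op n P f) = mean n pi f.
Proof.
  rewrite (mean_ext n pi _ (fun i => 1 * op n P f i)) by (intros; ring).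
  rewrite (op_selfadjoint n P pi f (fun _ => 1) Hrev).
  apply mean_ext. intros i Hi. rewrite op_const by assumption. ring.
Qed.

(** Jensen's inequality: the variance of [f] under row [i] of [P] is nonnegative. *)
Lemma op_sqr_le (f : nat -> R) (i : nat) :
  (i < n)%nat -> op n P f i ^ 2 <= op n P (fun j => f j ^ 2) i.
Proof.
  intros Hi. set (m := op n P f i).
  assert (H : 0 <= op n P (fun j => (f j - m) ^ 2) i).
  { rewrite <- (op_const 0 i Hi). apply op_le; [assumption|]. intros j _. apply pow2_ge_0. }
  rewrite (op_ext n P _ (fun j => 1 * f j ^ 2 + 1 * (m ^ 2 * 1 + (- 2 * m) * f j))) in H
    by (intros; ring).
  rewrite !op_lin, op_const in H by assumption. fold m in H. nra.
Qed.

Lemma variance_eq (f : nat -> R) :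
  variance n pi f = mean n pi (fun i => f i ^ 2) - mean n pi f ^ 2.
Proof.
  unfold variance. set (m := mean n pi f).
  rewrite (mean_ext n pi _ (fun i => 1 * f i ^ 2 + 1 * (m ^ 2 * 1 + (- 2 * m) * f i)))
    by (intros; ring).
  rewrite !mean_lin, mean_const. fold m. ring.
Qed.

Lemma variance_nonneg (f : nat -> R) : 0 <= variance n pi f.
Proof.
  apply mean_nonneg; [apply (proj1 Hpi)|]. intros i _. apply pow2_ge_0.
Qed.

Lemma variance_ge_term (f : nat -> R) (i : nat) :
  (i < n)%nat -> pi i * (f i - mean n pi f) ^ 2 <= variance n pi f.
Proof.
  intros Hi.
  apply (rsum_ge_term n i (fun k => pi k * (f k - mean n pi f) ^ 2)); [|assumption].
  intros k Hk. apply Rmult_le_pos; [now apply (proj1 Hpi)|apply pow2_ge_0].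
Qed.

Lemma dirichlet_eq (f : nat -> R) :
  dirichlet n P pi f
  = mean n pi (fun i => f i ^ 2) - mean n pi (fun i => f i * op n P f i).
Proof.
  unfold dirichlet.
  rewrite (mean_ext n pi _ (fun i => 1 * f i ^ 2 + (- 1) * (f i * op n P f i)))
    by (intros; ring).
  rewrite mean_lin. ring.
Qed.

(** * Contraction of the variance under the lazy kernel [(I + P) / 2] *)

Definition half (f : nat -> R) (i : nat) : R := (f i + op n P f i) / 2.

Lemma mean_half (f : nat -> R) : mean n pi (half f) = mean n pi f.
Proof.
  rewrite (mean_ext n pi _ (fun i => / 2 * f i + / 2 * op n P f i))
    by (intros; unfold half; field).
  rewrite mean_lin, mean_op. field.
Qed.

(* Laziness makes the kernel positive semidefinite, so that the Dirichlet form alone,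
   with no control of the negative eigenvalues, yields contraction. *)
Lemma variance_half (f : nat -> R) :
  variance n pi (half f) <= variance n pi f - dirichlet n P pi f / 2.
Proof.
  rewrite !variance_eq, mean_half, dirichlet_eq.
  assert (H : mean n pi (fun i => half f i ^ 2)
    <= mean n pi (fun i => / 4 * f i ^ 2
         + 1 * (/ 4 * op n P (fun j => f j ^ 2) i + / 2 * (f i * op n P f i)))).
  { apply mean_le; [apply (proj1 Hpi)|]. intros i Hi. pose proof (op_sqr_le f i Hi).
    unfold half. nra. }
  rewrite !mean_lin, mean_op in H. lra.
Qed.

Context (gam : R) (Hgam0 : 0 < gam) (Hgam1 : gam <= 1) (Hgap : poincare n P pi gam).

Lemma mean_iter_half (f : nat -> R) (t : nat) :
  mean n pi (Nat.iter t half f) = mean n pi f.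
Proof. induction t as [|t IH]; [reflexivity|]. simpl. now rewrite mean_half. Qed.

(** Each step loses half the Dirichlet form, which by the Poincare inequality is at least [gam / 2]
    times the variance. *)
Lemma variance_iter_half (f : nat -> R) (t : nat) :
  variance n pi (Nat.iter t half f) <= (1 - gam / 2) ^ t * variance n pi f.
Proof.
  induction t as [|t IH]; simpl; [lra|].
  set (u := Nat.iter t half f) in *.
  pose proof (variance_half u). pose proof (Hgap u).
  apply Rle_trans with ((1 - gam / 2) * variance n pi u); [lra|].
  rewrite Rmult_assoc. apply Rmult_le_compat_l; lra.
Qed.

Lemma half_le (f g : nat -> R) (i : nat) :
  (i < n)%nat -> (forall j, (j < n)%nat -> f j <= g j) -> half f i <= half g i.
Proof.
  intros Hi H. pose proof (H i Hi). pose proof (op_le f g i Hi H). unfold half. lra.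
Qed.

(** Averaging [f <= f] with [f <= 1 + P f] gives [f <= 1 / 2 + half f]. This iterates because [half]
    is monotone and commutes with adding constants. *)
Lemma subsolution_le_iter (f : nat -> R) (t : nat) :
  (forall i, (i < n)%nat -> f i <= 1 + op n P f i) ->
  forall i, (i < n)%nat -> f i <= INR t / 2 + Nat.iter t half f i.
Proof.
  intros Hf. induction t as [|t IH]; intros i Hi; [simpl; lra|].
  rewrite S_INR. simpl. set (u := Nat.iter t half f) in *.
  pose proof (half_le f (fun j => INR t / 2 + u j) i Hi IH) as H.
  unfold half in H at 2. rewrite op_shift in H by assumption.
  pose proof (Hf i Hi). unfold half in *. lra.
Qed.

Lemma pow_le_exp (a : R) (t : nat) : 0 <= 1 - a -> (1 - a) ^ t <= exp (- (a * INR t)).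
Proof.
  intros Ha. induction t as [|t IH].
  - simpl. rewrite Rmult_0_r, Ropp_0, exp_0. lra.
  - rewrite S_INR. replace (- (a * (INR t + 1))) with (- a + - (a * INR t)) by ring.
    rewrite exp_plus. simpl. pose proof (exp_ineq1_le (- a)).
    apply Rmult_le_compat; try lra. now apply pow_le.
Qed.

Lemma nat_ceiling (r : R) : 0 <= r -> exists t : nat, r <= INR t <= r + 1.
Proof.
  intros Hr. destruct (archimed r) as [H1 H2].
  exists (Z.to_nat (up r)). rewrite INR_IZR_INZ, Z2Nat.id; [lra|].
  apply le_IZR. lra.
Qed.

Lemma pi_set_le_1 (A : nat -> bool) : pi_set n pi A <= 1.
Proof.
  rewrite <- (proj2 Hpi). apply rsum_le. intros i Hi.
  pose proof (proj1 Hpi i Hi). destruct (A i); lra.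
Qed.

(** On [A] the squared deviation is exactly the squared mean; the rest of the variance is
    dropped. *)
Lemma variance_ge_set (A : nat -> bool) (f : nat -> R) :
  (forall i, (i < n)%nat -> A i = true -> f i = 0) ->
  pi_set n pi A * mean n pi f ^ 2 <= variance n pi f.
Proof.
  intros Hf. unfold variance. set (m := mean n pi f). unfold mean, pi_set.
  rewrite Rmult_comm, <- rsum_scal. apply rsum_le. intros i Hi.
  pose proof (proj1 Hpi i Hi). destruct (A i) eqn:HA.
  - rewrite Hf by assumption. apply Req_le. ring.
  - rewrite Rmult_0_r. apply Rmult_le_pos; [assumption|apply pow2_ge_0].
Qed.

(** The core estimate. It asks for the inequality [f <= 1 + P f] only, so that it covers truncated
    hitting times with a bound free of the horizon. *)
Lemma subsolution_bound (A : nat -> bool) (f : nat -> R) (p : R) :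
  0 < pi_set n pi A -> 0 < p -> (forall i, (i < n)%nat -> p <= pi i) ->
  (forall i, (i < n)%nat -> 0 <= f i) ->
  (forall i, (i < n)%nat -> A i = true -> f i = 0) ->
  (forall i, (i < n)%nat -> f i <= 1 + op n P f i) ->
  forall x, (x < n)%nat ->
    f x <= / 2 + ln (/ p) / gam + 2 * / pi_set n pi A / gam.
Proof.
  intros HA Hp Hpmin Hf0 HfA Hf x Hx.
  set (a := / pi_set n pi A).
  assert (Ha1 : 1 <= a).
  { unfold a. rewrite <- Rinv_1. apply Rinv_le_contravar; [assumption|apply pi_set_le_1]. }
  assert (Hp1 : p <= 1).
  { apply Rle_trans with (pi x); [auto|]. rewrite <- (proj2 Hpi).
    apply rsum_ge_term; [apply (proj1 Hpi)|assumption]. }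
  assert (Hln : 0 <= ln (/ p)).
  { rewrite <- ln_1. destruct (Req_dec p 1) as [->|Hne]; [rewrite Rinv_1; lra|].
    left. apply ln_increasing; [lra|]. rewrite <- Rinv_1. apply Rinv_lt_contravar; lra. }
  set (m := mean n pi f).
  assert (Hm0 : 0 <= m) by (apply mean_nonneg; [apply (proj1 Hpi)|assumption]).
  (* Pointwise, [f * (f - P f) <= f]. *)
  assert (Hdir : dirichlet n P pi f <= m).
  { apply mean_le; [apply (proj1 Hpi)|]. intros i Hi.
    pose proof (Hf i Hi). pose proof (Hf0 i Hi). nra. }
  pose proof (Hgap f) as HV. pose proof (variance_ge_set A f HfA) as HVA. fold m in HVA.
  (* From [gam * pi_set A * m ^ 2 <= gam * variance f <= m], after division by [m]. *)
  assert (Hm : m <= a / gam).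
  { assert (H : gam * pi_set n pi A * m <= 1).
    { destruct (Rle_lt_or_eq_dec 0 m Hm0) as [Hpos|<-]; [|lra].
      apply Rmult_le_reg_r with m; [assumption|]. nra. }
    unfold a. apply Rmult_le_reg_l with (gam * pi_set n pi A).
    - now apply Rmult_lt_0_compat.
    - replace (gam * pi_set n pi A * (/ pi_set n pi A / gam)) with 1 by (field; lra).
      assumption. }
  (* The variance is at most [m / gam <= a / gam ^ 2], and [1 <= a]. *)
  assert (HVf : variance n pi f <= (a / gam) ^ 2).
  { apply Rle_trans with (a / gam / gam).
    - apply Rmult_le_reg_l with gam; [assumption|].
      replace (gam * (a / gam / gam)) with (a / gam) by (field; lra). lra.
    - assert (0 < a / gam) by (apply Rdiv_lt_0_compat; lra).
      replace ((a / gam) ^ 2) with (a / gam * (a / gam)) by ring.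
      unfold Rdiv at 1. apply Rmult_le_compat_l; [lra|].
      unfold Rdiv. rewrite <- (Rmult_1_l (/ gam)) at 1.
      apply Rmult_le_compat_r; [|lra]. left. now apply Rinv_0_lt_compat. }
  (* The time at which [exp (- gam * t / 2)] falls to [p]. Rounding up costs at most 1, hence the
     term [/ 2] in the bound. *)
  destruct (nat_ceiling (2 * ln (/ p) / gam)) as [t [Ht1 Ht2]].
  { apply Rmult_le_pos; [lra|]. left. now apply Rinv_0_lt_compat. }
  assert (Hpow : (1 - gam / 2) ^ t <= p).
  { apply Rle_trans with (exp (- (gam / 2 * INR t))); [apply pow_le_exp; lra|].
    rewrite <- (exp_ln p Hp). rewrite <- (Ropp_involutive (ln p)), <- ln_Rinv by lra.
    assert (ln (/ p) <= gam / 2 * INR t).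
    { apply Rle_trans with (gam / 2 * (2 * ln (/ p) / gam)); [|apply Rmult_le_compat_l; lra].
      apply Req_le. field. lra. }
    destruct (Req_dec (ln (/ p)) (gam / 2 * INR t)) as [->|]; [lra|].
    left. apply exp_increasing. lra. }
  set (u := Nat.iter t half f).
  (* The contraction factor, at most [p], cancels the weight [pi x >= p] of the single point [x] in
     the variance. *)
  assert (Hdev : u x - m <= a / gam).
  { assert (Hsq : (u x - m) ^ 2 <= (a / gam) ^ 2).
    { apply Rle_trans with (variance n pi f); [|assumption].
      pose proof (variance_ge_term u x Hx) as H1.
      unfold u in H1 at 2. rewrite mean_iter_half in H1. fold m in H1.
      pose proof (variance_iter_half f t) as H2. fold u in H2.
      pose proof (Hpmin x Hx). pose proof (variance_nonneg f).
      pose proof (pow2_ge_0 (u x - m)).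
      apply Rmult_le_reg_l with p; [assumption|].
      apply Rle_trans with (pi x * (u x - m) ^ 2); [now apply Rmult_le_compat_r|].
      apply Rle_trans with (1 := H1). apply Rle_trans with (1 := H2).
      now apply Rmult_le_compat_r. }
    assert (0 < a / gam) by (apply Rdiv_lt_0_compat; lra). nra. }
  pose proof (subsolution_le_iter f t Hf x Hx) as H. fold u in H.
  fold a. unfold Rdiv in *. lra.
Qed.

(** * Mean hitting times *)

(* The expectation of the minimum of [T_A] and [t] for the chain started at [y]. *)
Fixpoint truncated_time (A : nat -> bool) (t : nat) (y : nat) : R :=
  match t with
  | O => 0
  | S t' => if A y then 0 else 1 + op n P (truncated_time A t') y
  end.

Lemma truncated_time_on (A : nat -> bool) (t y : nat) : A y = true -> truncated_time A t y = 0.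
Proof. intros HA. destruct t; simpl; [reflexivity|now rewrite HA]. Qed.

Lemma op_nonneg (f : nat -> R) (i : nat) :
  (i < n)%nat -> (forall j, (j < n)%nat -> 0 <= f j) -> 0 <= op n P f i.
Proof. intros Hi H. rewrite <- (op_const 0 i Hi). now apply op_le. Qed.

Lemma op_le_1 (f : nat -> R) (i : nat) :
  (i < n)%nat -> (forall j, (j < n)%nat -> f j <= 1) -> op n P f i <= 1.
Proof. intros Hi H. rewrite <- (op_const 1 i Hi). now apply op_le. Qed.

Lemma truncated_time_nonneg (A : nat -> bool) (t y : nat) :
  (y < n)%nat -> 0 <= truncated_time A t y.
Proof.
  revert y. induction t as [|t IH]; intros y Hy; simpl; [lra|].
  destruct (A y); [lra|]. pose proof (op_nonneg _ y Hy IH). lra.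
Qed.

Lemma truncated_time_growing (A : nat -> bool) (y : nat) :
  (y < n)%nat -> Un_growing (fun t => truncated_time A t y).
Proof.
  intros Hy t. revert y Hy. induction t as [|t IH]; intros y Hy.
  - apply truncated_time_nonneg, Hy.
  - cbn [truncated_time]. destruct (A y); [lra|].
    apply Rplus_le_compat_l. apply op_le; [assumption|]. intros j Hj. now apply IH.
Qed.

Lemma op_cv (u : nat -> nat -> R) (l : nat -> R) (i : nat) :
  (forall j, (j < n)%nat -> Un_cv (fun t => u t j) (l j)) ->
  Un_cv (fun t => op n P (u t) i) (op n P l i).
Proof.
  intros H. unfold op. apply (rsum_cv n (fun t j => P i j * u t j) (fun j => P i j * l j)).
  intros j Hj. apply (CV_mult (fun _ => P i j)); [apply const_cv|auto].
Qed.

(** The truncated times increase with the horizon and are uniformly bounded, so they converge; the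
    limit [g] inherits the bound and the first-step equation. *)
Lemma truncated_time_cv (A : nat -> bool) (p : R) :
  0 < pi_set n pi A -> 0 < p -> (forall i, (i < n)%nat -> p <= pi i) ->
  exists g : nat -> R,
    (forall y, (y < n)%nat -> A y = true -> g y = 0) /\
    (forall y, (y < n)%nat -> A y = false -> g y = 1 + op n P g y) /\
    (forall y, (y < n)%nat -> g y <= / 2 + ln (/ p) / gam + 2 * / pi_set n pi A / gam).
Proof.
  intros HA Hp Hpmin. set (B := / 2 + ln (/ p) / gam + 2 * / pi_set n pi A / gam).
  assert (Hb : forall t y, (y < n)%nat -> truncated_time A t y <= B).
  { intros t y Hy. apply subsolution_bound; try assumption.
    - intros i Hi. now apply truncated_time_nonneg.
    - intros i Hi HAi. now apply truncated_time_on.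
    (* Growth in the horizon turns the recursion for [t + 1] into the inequality [f <= 1 + P f] for
       [t]. *)
    - intros i Hi. apply Rle_trans with (1 := truncated_time_growing A i Hi t).
      simpl. destruct (A i); [|lra].
      assert (0 <= op n P (truncated_time A t) i); [|lra].
      apply op_nonneg; [assumption|]. intros j Hj. now apply truncated_time_nonneg. }
  set (g := fun y => lim_seq (fun t => truncated_time A t y)).
  assert (Hg : forall y, (y < n)%nat -> Un_cv (fun t => truncated_time A t y) (g y)).
  { intros y Hy. apply growing_lim_seq with B; [now apply truncated_time_growing|].
    intros t. now apply Hb. }
  exists g. split; [|split]; intros y Hy.
  - intros HAy. apply (UL_sequence (fun t => truncated_time A t y)); [auto|].
    intros eps Heps. exists 0%nat. intros t _.
    rewrite truncated_time_on, Rdist_eq; assumption.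
  - intros HAy.
    apply (UL_sequence (fun t => truncated_time A (S t) y)).
    { now apply (cv_succ (fun t => truncated_time A t y)), Hg. }
    simpl. rewrite HAy. apply (CV_plus (fun _ => 1)); [apply const_cv|now apply op_cv].
  - apply cv_le_bound with (1 := Hg y Hy). intros t. now apply Hb.
Qed.

(** * Harmonic measure *)

Lemma hit_fin_S (A : nat -> bool) (x t y : nat) :
  hit_fin n P A x (S t) y
  = if A y then (if Nat.eqb y x then 1 else 0) else op n P (hit_fin n P A x t) y.
Proof. reflexivity. Qed.

Lemma hit_fin_range (A : nat -> bool) (x t y : nat) :
  (y < n)%nat -> 0 <= hit_fin n P A x t y <= 1.
Proof.
  revert y. induction t as [|t IH]; intros y Hy.
  - simpl. destruct (A y), (Nat.eqb y x); lra.
  - rewrite hit_fin_S. destruct (A y); [destruct (Nat.eqb y x); lra|].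
    split; [apply op_nonneg|apply op_le_1]; try assumption; intros j Hj; now apply IH.
Qed.

Lemma hit_fin_growing (A : nat -> bool) (x y : nat) :
  (y < n)%nat -> Un_growing (fun t => hit_fin n P A x t y).
Proof.
  intros Hy t. revert y Hy. induction t as [|t IH]; intros y Hy; rewrite hit_fin_S.
  - simpl. destruct (A y); [lra|]. apply op_nonneg; [assumption|].
    intros j Hj. now apply (hit_fin_range A x 0).
  - rewrite hit_fin_S. destruct (A y); [lra|].
    apply op_le; [assumption|]. intros j Hj. now apply IH.
Qed.

Lemma hmeas_cv (A : nat -> bool) (x y : nat) :
  (y < n)%nat -> Un_cv (fun t => hit_fin n P A x t y) (hmeas n P A y x).
Proof.
  intros Hy. apply growing_lim_seq with 1; [now apply hit_fin_growing|].
  intros t. now apply hit_fin_range.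
Qed.

Lemma hmeas_on (A : nat -> bool) (x y : nat) :
  (y < n)%nat -> A y = true -> hmeas n P A y x = if Nat.eqb y x then 1 else 0.
Proof.
  intros Hy HA. apply (UL_sequence (fun t => hit_fin n P A x t y)); [now apply hmeas_cv|].
  intros eps Heps. exists 0%nat. intros t _.
  replace (hit_fin n P A x t y) with (if Nat.eqb y x then 1 else 0)
    by (destruct t; simpl; now rewrite HA).
  now rewrite Rdist_eq.
Qed.

Lemma hmeas_off (A : nat -> bool) (x y : nat) :
  (y < n)%nat -> A y = false ->
  hmeas n P A y x = op n P (fun z => hmeas n P A z x) y.
Proof.
  intros Hy HA. apply (UL_sequence (fun t => hit_fin n P A x (S t) y)).
  - apply (cv_succ (fun t => hit_fin n P A x t y)). now apply hmeas_cv.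
  - simpl. rewrite HA. apply (op_cv (fun t z => hit_fin n P A x t z)).
    intros j Hj. now apply hmeas_cv.
Qed.

(* [g] is the mean of [T_A], so [1 + op n P g x] is the mean return time to [A] from [x]. *)
Lemma hstat_return_time (A : nat -> bool) (g : nat -> R) (x : nat) :
  (forall y, (y < n)%nat -> A y = true -> g y = 0) ->
  (forall y, (y < n)%nat -> A y = false -> g y = 1 + op n P g y) ->
  (x < n)%nat -> A x = true ->
  hstat n P pi A x = pi x * (1 + op n P g x).
Proof.
  intros HgA Hg Hx HAx. set (h := fun y => hmeas n P A y x).
  change (mean n pi h = pi x * (1 + op n P g x)).
  rewrite <- (mean_delta n pi x (fun i => 1 + op n P g i) Hx).
  (* By self-adjointness this function has mean zero. Added to [d] it equals [h] pointwise: on [A]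
     because [g] vanishes and [h] is the indicator of [x], off [A] because [h] is harmonic and
     [g - P g = 1]. *)
  assert (H0 : mean n pi (fun i => 1 * (g i * op n P h i) + (- 1) * (h i * op n P g i)) = 0).
  { rewrite mean_lin, (op_selfadjoint n P pi g h Hrev). ring. }
  set (k := fun i => 1 * (g i * op n P h i) + (- 1) * (h i * op n P g i)) in H0.
  set (d := fun i => if Nat.eqb i x then 1 + op n P g i else 0).
  transitivity (1 * mean n pi d + 1 * mean n pi k); [|rewrite H0; ring].
  rewrite <- mean_lin. apply mean_ext. intros i Hi. unfold d, k.
  destruct (A i) eqn:HAi.
  - unfold h at 1 3. rewrite hmeas_on, HgA by assumption.
    destruct (Nat.eqb_spec i x); subst; ring.
  - destruct (Nat.eqb_spec i x); [congruence|].
    pose proof (hmeas_off A x i Hi HAi) as Hh. pose proof (Hg i Hi HAi) as Hgi.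
    fold h in Hh. fold (h i) in Hh. rewrite <- Hh, Hgi. ring.
Qed.

(** * Escape probabilities *)

Lemma avoid_fin_S (x y t z : nat) :
  avoid_fin n P x y (S t) z
  = if Nat.eqb z y then 1 else if Nat.eqb z x then 0 else op n P (avoid_fin n P x y t) z.
Proof. reflexivity. Qed.

Lemma avoid_fin_range (x y t z : nat) :
  (z < n)%nat -> 0 <= avoid_fin n P x y t z <= 1.
Proof.
  revert z. induction t as [|t IH]; intros z Hz.
  - simpl. destruct (Nat.eqb z y), (Nat.eqb z x); lra.
  - rewrite avoid_fin_S. destruct (Nat.eqb z y); [lra|]. destruct (Nat.eqb z x); [lra|].
    split; [apply op_nonneg|apply op_le_1]; try assumption; intros j Hj; now apply IH.
Qed.

Lemma avoid_fin_growing (x y z : nat) :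
  (z < n)%nat -> Un_growing (fun t => avoid_fin n P x y t z).
Proof.
  intros Hz t. revert z Hz. induction t as [|t IH]; intros z Hz; rewrite avoid_fin_S.
  - simpl. destruct (Nat.eqb z y); [lra|]. destruct (Nat.eqb z x); [lra|].
    apply op_nonneg; [assumption|]. intros j Hj. now apply (avoid_fin_range x y 0).
  - rewrite avoid_fin_S. destruct (Nat.eqb z y); [lra|]. destruct (Nat.eqb z x); [lra|].
    apply op_le; [assumption|]. intros j Hj. now apply IH.
Qed.

(** The potential [a z] is the probability of reaching [y] before [x] from [z], the monotone limit
    of [avoid_fin]. One step from [x] makes it the escape probability. *)
Lemma escape_equilibrium (x y : nat) :
  (x < n)%nat -> (y < n)%nat -> x <> y ->
  exists a : nat -> R,
    a x = 0 /\ a y = 1 /\ escape n P x y = op n P a x /\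
    (forall z, (z < n)%nat -> 0 <= a z <= 1) /\
    (forall z, (z < n)%nat -> z <> x -> z <> y -> a z = op n P a z).
Proof.
  intros Hx Hy Hxy. set (a := fun z => lim_seq (fun t => avoid_fin n P x y t z)).
  assert (Ha : forall z, (z < n)%nat -> Un_cv (fun t => avoid_fin n P x y t z) (a z)).
  { intros z Hz. apply growing_lim_seq with 1; [now apply avoid_fin_growing|].
    intros t. now apply avoid_fin_range. }
  exists a. split; [|split; [|split; [|split]]].
  - apply lim_seq_eq. intros eps Heps. exists 0%nat. intros t _.
    replace (avoid_fin n P x y t x) with 0; [now rewrite Rdist_eq|].
    destruct t; simpl; rewrite Nat.eqb_refl; now destruct (Nat.eqb_spec x y).
  - apply lim_seq_eq. intros eps Heps. exists 0%nat. intros t _.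
    replace (avoid_fin n P x y t y) with 1; [now rewrite Rdist_eq|].
    destruct t; simpl; now rewrite Nat.eqb_refl.
  - apply lim_seq_eq. now apply (op_cv (fun t z => avoid_fin n P x y t z)).
  - intros z Hz. split.
    + apply cv_ge_bound with (1 := Ha z Hz). intros t. now apply avoid_fin_range.
    + apply cv_le_bound with (1 := Ha z Hz). intros t. now apply avoid_fin_range.
  - intros z Hz Hzx Hzy. apply (UL_sequence (fun t => avoid_fin n P x y (S t) z)).
    + apply (cv_succ (fun t => avoid_fin n P x y t z)). now apply Ha.
    + simpl. destruct (Nat.eqb_spec z y); [congruence|].
      destruct (Nat.eqb_spec z x); [congruence|].
      now apply (op_cv (fun t z => avoid_fin n P x y t z)).
Qed.

(* For the equilibrium potential this is [pi x * escape n P x y], an effective conductance. *)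
Lemma dirichlet_equilibrium (a : nat -> R) (x y : nat) :
  (x < n)%nat -> a x = 0 -> a y = 1 ->
  (forall z, (z < n)%nat -> z <> x -> z <> y -> a z = op n P a z) ->
  dirichlet n P pi a = pi x * op n P a x.
Proof.
  intros Hx Hax Hay Ha. rewrite <- (mean_delta n pi x (op n P a) Hx).
  (* The net flow [a - P a] has mean zero by stationarity and vanishes off [x] and [y]. Adding it to
     [d] gives the integrand of the Dirichlet form at each state. *)
  assert (H0 : mean n pi (fun i => 1 * a i + (- 1) * op n P a i) = 0).
  { rewrite mean_lin, mean_op. ring. }
  set (k := fun i => 1 * a i + (- 1) * op n P a i) in H0.
  set (d := fun i => if Nat.eqb i x then op n P a i else 0).
  transitivity (1 * mean n pi d + 1 * mean n pi k); [|rewrite H0; ring].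
  rewrite <- mean_lin. apply mean_ext. intros i Hi. unfold d, k.
  destruct (Nat.eqb_spec i x) as [->|Hix]; [rewrite Hax; ring|].
  destruct (Nat.eq_dec i y) as [->|Hiy]; [rewrite Hay; ring|].
  rewrite <- (Ha i Hi Hix Hiy). ring.
Qed.

Lemma escape_bounds (x y : nat) (p q : R) :
  (x < n)%nat -> (y < n)%nat -> x <> y ->
  0 < p -> (forall i, (i < n)%nat -> p <= pi i <= q) ->
  gam * p / (2 * q) <= escape n P x y <= 1.
Proof.
  intros Hx Hy Hxy Hp Hpq.
  destruct (escape_equilibrium x y Hx Hy Hxy) as (a & Hax & Hay & He & Har & Ha).
  rewrite He. split; [|apply op_le_1; [assumption|]; intros j Hj; now apply Har].
  pose proof (dirichlet_equilibrium a x y Hx Hax Hay Ha) as HD.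
  pose proof (Hgap a) as HV.
  set (m := mean n pi a).
  assert (H2 : pi x * m ^ 2 + pi y * (1 - m) ^ 2 <= variance n pi a).
  { replace (pi x * m ^ 2) with (pi x * (a x - m) ^ 2) by (rewrite Hax; ring).
    rewrite <- Hay.
    apply (rsum_ge_two_terms n x y (fun i => pi i * (a i - m) ^ 2)); try assumption.
    intros i Hi. apply Rmult_le_pos; [now apply (proj1 Hpi)|apply pow2_ge_0]. }
  destruct (Hpq x Hx) as [Hpx Hqx]. destruct (Hpq y Hy) as [Hpy _].
  (* Both weights are at least [p], and [m ^ 2 + (1 - m) ^ 2 = (1 + (2 * m - 1) ^ 2) / 2]. *)
  assert (Hvar : p / 2 <= variance n pi a).
  { apply Rle_trans with (2 := H2). pose proof (pow2_ge_0 m). pose proof (pow2_ge_0 (1 - m)).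
    pose proof (pow2_ge_0 (2 * m - 1)). nra. }
  assert (He0 : 0 <= op n P a x) by (apply op_nonneg; [assumption|]; intros j Hj; now apply Har).
  apply Rmult_le_reg_l with q; [lra|].
  replace (q * (gam * p / (2 * q))) with (gam * (p / 2)) by (field; lra).
  apply Rle_trans with (gam * variance n pi a); [apply Rmult_le_compat_l; lra|].
  apply Rle_trans with (1 := HV). rewrite HD. now apply Rmult_le_compat_r.
Qed.
End Chain.

(** * Extrema over lists, and the bounds for [uP] and [hstat] under a Poincare inequality *)

Lemma fold_Rmin_le_init (a : R) (l : list R) : fold_right Rmin a l <= a.
Proof.
  induction l as [|b l IH]; simpl; [lra|]. apply Rle_trans with (2 := IH). apply Rmin_r.
Qed.

Lemma fold_Rmin_le (a b : R) (l : list R) : In b l -> fold_right Rmin a l <= b.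
Proof.
  induction l as [|c l IH]; simpl; [tauto|]. intros [->|H]; [apply Rmin_l|].
  apply Rle_trans with (2 := IH H). apply Rmin_r.
Qed.

Lemma fold_Rmin_ge (a c : R) (l : list R) :
  c <= a -> (forall b, In b l -> c <= b) -> c <= fold_right Rmin a l.
Proof.
  intros Ha. induction l as [|b l IH]; simpl; intros H; [assumption|].
  apply Rmin_glb; auto.
Qed.

Lemma fold_Rmax_ge (a b : R) (l : list R) : In b l -> b <= fold_right Rmax a l.
Proof.
  induction l as [|c l IH]; simpl; [tauto|]. intros [->|H]; [apply Rmax_l|].
  apply Rle_trans with (1 := IH H). apply Rmax_r.
Qed.

Lemma fold_Rmax_ge_init (a : R) (l : list R) : a <= fold_right Rmax a l.
Proof.
  induction l as [|b l IH]; simpl; [lra|]. apply Rle_trans with (1 := IH). apply Rmax_r.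
Qed.

Lemma fold_Rmax_lt (a c : R) (l : list R) :
  a < c -> (forall b, In b l -> b < c) -> fold_right Rmax a l < c.
Proof.
  intros Ha. induction l as [|b l IH]; simpl; intros H; [assumption|].
  apply Rmax_lub_lt; auto.
Qed.

Lemma in_map_seq (n i : nat) (f : nat -> R) : (i < n)%nat -> In (f i) (map f (seq 0 n)).
Proof. intros Hi. apply in_map, in_seq. lia. Qed.

Lemma pi_min_le (n i : nat) (pi : nat -> R) : (i < n)%nat -> pi_min n pi <= pi i.
Proof. intros Hi. now apply fold_Rmin_le, in_map_seq. Qed.

Lemma pi_max_ge (n i : nat) (pi : nat -> R) : (i < n)%nat -> pi i <= pi_max n pi.
Proof. intros Hi. now apply fold_Rmax_ge, in_map_seq. Qed.

Lemma pi_min_pos (n : nat) (pi : nat -> R) :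
  (0 < n)%nat -> (forall i, (i < n)%nat -> 0 < pi i) -> 0 < pi_min n pi.
Proof.
  intros Hn H. assert (H0 : 0 < pi 0%nat) by auto. unfold pi_min.
  assert (Hl : forall b, In b (map pi (seq 0 n)) -> 0 < b).
  { intros b Hb. apply in_map_iff in Hb. destruct Hb as (i & <- & Hi).
    apply in_seq in Hi. apply H. lia. }
  induction (map pi (seq 0 n)) as [|b l IH]; simpl; [assumption|].
  apply Rmin_glb_lt; [apply Hl; now left|]. apply IH. intros c Hc. apply Hl. now right.
Qed.

(** The fold defining [uP] starts from [escape n P 0 1], so this value dominates it. *)
Lemma uP_le_1 (n : nat) (P : nat -> nat -> R) :
  escape n P 0 1 <= 1 -> uP n P <= 1.
Proof. intros H. apply Rle_trans with (2 := H). apply fold_Rmin_le_init. Qed.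

Lemma uP_ge (n : nat) (P : nat -> nat -> R) (c : R) :
  (2 <= n)%nat ->
  (forall x y, (x < n)%nat -> (y < n)%nat -> x <> y -> c <= escape n P x y) ->
  c <= uP n P.
Proof.
  intros Hn H. apply fold_Rmin_ge; [apply H; lia|]. intros b Hb.
  apply in_map_iff in Hb. destruct Hb as ([x y] & <- & Hxy). simpl.
  apply in_flat_map in Hxy. destruct Hxy as (i & Hi & Hxy).
  apply in_map_iff in Hxy. destruct Hxy as (j & Hij & Hj). injection Hij as <- <-.
  apply filter_In in Hj. destruct Hj as [Hj Hne]. apply in_seq in Hi, Hj.
  apply H; [lia|lia|]. intros ->. now rewrite Nat.eqb_refl in Hne.
Qed.

Lemma pi_set_pos (n x : nat) (pi : nat -> R) (A : nat -> bool) :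
  (forall i, (i < n)%nat -> 0 < pi i) -> (x < n)%nat -> A x = true -> 0 < pi_set n pi A.
Proof.
  intros Hpi Hx HA. apply Rlt_le_trans with (pi x); [auto|].
  replace (pi x) with (if A x then pi x else 0) by now rewrite HA.
  apply (rsum_ge_term n x (fun i => if A i then pi i else 0)); [|assumption].
  intros i Hi. specialize (Hpi i Hi). destruct (A i); lra.
Qed.

Lemma uP_bounds (n : nat) (P : nat -> nat -> R) (pi : nat -> R) (gam : R) :
  (2 <= n)%nat -> stochastic n P -> prob_measure n pi -> reversible n P pi ->
  (forall i, (i < n)%nat -> 0 < pi i) -> 0 < gam -> poincare n P pi gam ->
  gam * pi_min n pi / (2 * pi_max n pi) <= uP n P <= 1.
Proof.
  intros Hn Hsto Hpi Hrev Hpos Hgam Hgap.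
  assert (H : forall x y, (x < n)%nat -> (y < n)%nat -> x <> y ->
    gam * pi_min n pi / (2 * pi_max n pi) <= escape n P x y <= 1).
  { intros x y Hx Hy Hxy. apply escape_bounds with (pi := pi); try assumption.
    - apply pi_min_pos; [lia|assumption].
    - intros i Hi. split; [now apply pi_min_le|now apply pi_max_ge]. }
  split; [apply uP_ge; [assumption|]; intros x y Hx Hy Hxy; now apply H|].
  apply uP_le_1, H; lia.
Qed.

(** The pointwise bound on mean hitting times is averaged over one step from [x] and inserted into
    the return time identity. *)
Lemma hstat_le (n : nat) (P : nat -> nat -> R) (pi : nat -> R) (gam : R)
  (A : nat -> bool) (x : nat) :
  stochastic n P -> prob_measure n pi -> reversible n P pi ->
  (forall i, (i < n)%nat -> 0 < pi i) -> 0 < gam -> gam <= 1 -> poincare n P pi gam ->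
  (x < n)%nat -> A x = true ->
  hstat n P pi A x
  <= 5 / gam * pi x * Rmax (ln (2 * exp 1 / pi_min n pi)) (/ pi_set n pi A).
Proof.
  intros Hsto Hpi Hrev Hpos Hgam0 Hgam1 Hgap Hx HA.
  set (p := pi_min n pi). set (a := / pi_set n pi A).
  assert (Hp : 0 < p) by (apply pi_min_pos; [lia|assumption]).
  assert (HSA : 0 < pi_set n pi A) by (apply pi_set_pos with x; assumption).
  destruct (truncated_time_cv n P pi Hsto Hpi Hrev gam Hgam0 Hgam1 Hgap A p HSA Hp)
    as (g & HgA & Hg & HgB).
  { intros i Hi. now apply pi_min_le. }
  rewrite (hstat_return_time n P pi Hsto Hrev A g x HgA Hg Hx HA).
  fold a in HgB. set (B := / 2 + ln (/ p) / gam + 2 * a / gam) in HgB.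
  assert (HB : op n P g x <= B).
  { rewrite <- (op_const n P Hsto B x Hx). apply op_le; assumption. }
  set (L := Rmax (ln (2 * exp 1 / p)) a).
  assert (Hln : ln (2 * exp 1 / p) = ln 2 + 1 + ln (/ p)).
  { unfold Rdiv. pose proof (exp_pos 1). pose proof (Rinv_0_lt_compat p Hp).
    rewrite !ln_mult, ln_exp; lra. }
  pose proof (Rmax_l (ln (2 * exp 1 / p)) a) as HL1. fold L in HL1. rewrite Hln in HL1.
  pose proof (Rmax_r (ln (2 * exp 1 / p)) a) as HL2. fold L in HL2.
  pose proof ln_lt_2.
  assert (Ha1 : 1 <= a).
  { unfold a. rewrite <- Rinv_1. apply Rinv_le_contravar; [assumption|].
    apply (pi_set_le_1 n pi Hpi). }
  rewrite (Rmult_comm (5 / gam)), Rmult_assoc. apply Rmult_le_compat_l; [left; auto|].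
  apply Rle_trans with (1 + B); [lra|].
  apply Rmult_le_reg_l with gam; [assumption|].
  replace (gam * (5 / gam * L)) with (5 * L) by (field; lra).
  (* As [gam <= 1] and [ln 2 > 1 / 2], the first two terms are at most [L]; the last is at most
     [2 * L]. The constant 5 leaves room. *)
  replace (gam * (1 + B)) with (3 / 2 * gam + ln (/ p) + 2 * a)
    by (unfold B; field; lra).
  lra.
Qed.

Lemma escape_factor_le (u gam C K : R) :
  0 < u -> u <= 1 -> 0 < gam -> 0 <= C -> 0 <= K -> C / gam * K <= C / (u * gam) * K.
Proof.
  intros Hu0 Hu1 Hgam HC HK. apply Rmult_le_compat_r; [assumption|].
  unfold Rdiv. apply Rmult_le_compat_l; [assumption|].
  apply Rinv_le_contravar; [now apply Rmult_lt_0_compat|].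
  rewrite <- (Rmult_1_l gam) at 2. apply Rmult_le_compat_r; lra.
Qed.

(** Inverting the lower bound on the escape probability produces the second factor [/ gam] and the
    ratio [q / p]. *)
Lemma inv_escape_factor_le (u gam p q C K : R) :
  0 < gam -> 0 < p -> 0 < q -> gam * p / (2 * q) <= u -> 0 <= C -> 0 <= K ->
  C / (u * gam) * K <= 2 * C * q / (gam ^ 2 * p) * K.
Proof.
  intros Hgam Hp Hq Hu HC HK. apply Rmult_le_compat_r; [assumption|].
  replace (2 * C * q / (gam ^ 2 * p)) with (C * / (gam * p / (2 * q) * gam))
    by (field; repeat split; lra).
  unfold Rdiv at 1. apply Rmult_le_compat_l; [assumption|].
  assert (0 < gam * p / (2 * q)).
  { apply Rdiv_lt_0_compat; [now apply Rmult_lt_0_compat|lra]. }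
  apply Rinv_le_contravar; [now apply Rmult_lt_0_compat|]. apply Rmult_le_compat_r; lra.
Qed.

(** * The Poincare inequality from the spectrum *)

Lemma mpow_nonneg (n : nat) (P : nat -> nat -> R) (t i j : nat) :
  (forall i j, (i < n)%nat -> (j < n)%nat -> 0 <= P i j) ->
  (i < n)%nat -> (j < n)%nat -> 0 <= mpow n P t i j.
Proof.
  intros HP. revert i. induction t as [|t IH]; intros i Hi Hj; simpl.
  - destruct (Nat.eqb i j); lra.
  - apply rsum_nonneg. intros k Hk. apply Rmult_le_pos; auto.
Qed.

Lemma mpow_S_pos (n : nat) (P : nat -> nat -> R) (t i j : nat) :
  (forall i j, (i < n)%nat -> (j < n)%nat -> 0 <= P i j) ->
  (i < n)%nat -> (j < n)%nat -> 0 < mpow n P (S t) i j ->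
  exists k, (k < n)%nat /\ 0 < P i k /\ 0 < mpow n P t k j.
Proof.
  intros HP Hi Hj H. simpl in H.
  destruct (rsum_pos_term _ _ H) as (k & Hk & Hpos). exists k.
  pose proof (HP i k Hi Hk). pose proof (mpow_nonneg n P t k j HP Hk Hj).
  split; [assumption|]. split; nra.
Qed.

(** Some state has positive mass, and detailed balance carries positivity across each edge of a
    path. *)
Lemma irreducible_pi_pos (n : nat) (P : nat -> nat -> R) (pi : nat -> R) :
  stochastic n P -> prob_measure n pi -> reversible n P pi -> irreducible n P ->
  forall i, (i < n)%nat -> 0 < pi i.
Proof.
  intros [HP _] [Hpi0 Hpi1] Hrev Hirr.
  destruct (rsum_pos_term n pi) as (k & Hk & Hpk); [rewrite Hpi1; lra|].
  intros i Hi. destruct (Hirr k i Hk Hi) as [t Ht].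
  revert k Hk Hpk Ht. induction t as [|t IH]; intros k Hk Hpk Ht.
  - simpl in Ht. destruct (Nat.eqb_spec k i) as [->|]; [assumption|lra].
  - destruct (mpow_S_pos n P t k i HP Hk Hi Ht) as (l & Hl & HPl & Hlt).
    apply (IH l); try assumption.
    pose proof (Hrev k l Hk Hl). pose proof (Hpi0 l Hl). pose proof (HP l k Hl Hk).
    pose proof (Rmult_lt_0_compat _ _ Hpk HPl). nra.
Qed.

(** * Eigenvectors of irreducible reversible kernels *)

Definition eigenvector (n : nat) (P : nat -> nat -> R) (l : R) (f : nat -> R) : Prop :=
  forall i, (i < n)%nat -> op n P f i = l * f i.

Lemma independent_nonzero (n : nat) (f : nat -> nat -> R) (j : nat) :
  (forall c : nat -> R,
     (forall i, (i < n)%nat -> rsum n (fun j => c j * f j i) = 0) ->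
     forall j, (j < n)%nat -> c j = 0) ->
  (j < n)%nat -> exists i, (i < n)%nat /\ f j i <> 0.
Proof.
  intros Hind Hj. apply NNPP. intros Hno.
  assert (H : (if Nat.eqb j j then 1 else 0) = 0).
  { apply (Hind (fun k => if Nat.eqb k j then 1 else 0)); [|assumption].
    intros i Hi. rewrite (rsum_ext n _ (fun k => if Nat.eqb k j then f k i else 0)).
    - rewrite rsum_delta by assumption. apply NNPP. intros Hne. apply Hno. now exists i.
    - intros k _. destruct (Nat.eqb k j); ring. }
  rewrite Nat.eqb_refl in H. lra.
Qed.

Section Eigen.
Context (n : nat) (P : nat -> nat -> R) (pi : nat -> R).
Context (Hsto : stochastic n P) (Hpi : prob_measure n pi) (Hrev : reversible n P pi).
Context (Hirr : irreducible n P).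

Let Hpos : forall i, (i < n)%nat -> 0 < pi i :=
  irreducible_pi_pos n P pi Hsto Hpi Hrev Hirr.

Lemma mean_sqr_pos (f : nat -> R) (i : nat) :
  (i < n)%nat -> f i <> 0 -> 0 < mean n pi (fun k => f k ^ 2).
Proof.
  intros Hi Hf. apply Rlt_le_trans with (pi i * f i ^ 2).
  - apply Rmult_lt_0_compat; [auto|]. rewrite <- Rsqr_pow2. now apply Rsqr_pos_lt.
  - apply (rsum_ge_term n i (fun k => pi k * f k ^ 2)); [|assumption].
    intros k Hk. apply Rmult_le_pos; [left; auto|apply pow2_ge_0].
Qed.

(** By Jensen and stationarity, [P] contracts the norm [mean (f ^ 2)]. *)
Lemma eigenvalue_sqr_le_1 (l : R) (f : nat -> R) (i : nat) :
  eigenvector n P l f -> (i < n)%nat -> f i <> 0 -> l ^ 2 <= 1.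
Proof.
  intros Hf Hi Hfi. pose proof (mean_sqr_pos f i Hi Hfi) as H0.
  (* The dummy summand [0 * 0] gives the shape that [mean_lin] rewrites. *)
  assert (H : mean n pi (fun k => l ^ 2 * f k ^ 2 + 0 * 0)
    <= mean n pi (op n P (fun k => f k ^ 2))).
  { apply mean_le; [apply (proj1 Hpi)|]. intros k Hk.
    apply Rle_trans with (2 := op_sqr_le n P Hsto f k Hk).
    rewrite (Hf k Hk). apply Req_le. ring. }
  rewrite mean_lin, (mean_op n P pi Hsto Hrev) in H. nra.
Qed.

(** Equality in Jensen's inequality. The case [s = 1] makes harmonic functions constant; [s = -1]
    detects period 2. *)
Lemma unit_eigenvector_edge (s : R) (f : nat -> R) (i j : nat) :
  s ^ 2 = 1 -> eigenvector n P s f -> (i < n)%nat -> (j < n)%nat -> 0 < P i j ->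
  f j = s * f i.
Proof.
  intros Hs Hf Hi Hj Hij.
  (* [q i] is the mean of [(f X_1 - s * f X_0)^2] from [i]; its stationary mean is zero. *)
  set (q := fun i => op n P (fun j => (f j - s * f i) ^ 2) i).
  assert (Hq0 : forall k, (k < n)%nat -> 0 <= q k).
  { intros k Hk. apply op_nonneg; [assumption..|]. intros. apply pow2_ge_0. }
  assert (Hq : mean n pi q = 0).
  { rewrite (mean_ext n pi q
      (fun k => 1 * op n P (fun j => f j ^ 2) k + (- 1) * f k ^ 2)).
    - rewrite mean_lin, (mean_op n P pi Hsto Hrev). ring.
    - intros k Hk. unfold q.
      rewrite (op_ext n P _ (fun j => 1 * f j ^ 2
        + 1 * ((- 2 * s * f k) * f j + (s * f k) ^ 2 * 1))) by (intros; ring).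
      rewrite !op_lin, (op_const n P Hsto) by assumption. rewrite (Hf k Hk).
      replace ((s * f k) ^ 2) with (s ^ 2 * f k ^ 2) by ring.
      replace (- 2 * s * f k * (s * f k)) with (- 2 * s ^ 2 * f k ^ 2) by ring.
      rewrite Hs. ring. }
  assert (Hqi : pi i * q i = 0).
  { apply (rsum_eq_0_term n i (fun k => pi k * q k)); [|now apply Req_le|assumption].
    intros k Hk. apply Rmult_le_pos; [left|]; auto. }
  assert (Hqi' : q i = 0).
  { destruct (Rmult_integral _ _ Hqi) as [H|H]; [|assumption]. specialize (Hpos i Hi). lra. }
  assert (Hj0 : P i j * (f j - s * f i) ^ 2 = 0).
  { apply (rsum_eq_0_term n j (fun k => P i k * (f k - s * f i) ^ 2));
      [|now apply Req_le|assumption].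
    intros k Hk. apply Rmult_le_pos; [now apply (proj1 Hsto)|apply pow2_ge_0]. }
  destruct (Rmult_integral _ _ Hj0) as [H|H]; [lra|].
  simpl in H. rewrite Rmult_1_r in H. apply Rsqr_0_uniq in H. lra.
Qed.

Lemma unit_eigenvector_path (s : R) (f : nat -> R) (t i j : nat) :
  s ^ 2 = 1 -> eigenvector n P s f -> (i < n)%nat -> (j < n)%nat -> 0 < mpow n P t i j ->
  f j = s ^ t * f i.
Proof.
  intros Hs Hf. revert i. induction t as [|t IH]; intros i Hi Hj Ht.
  - simpl in *. destruct (Nat.eqb_spec i j) as [->|]; [ring|lra].
  - destruct (mpow_S_pos n P t i j (proj1 Hsto) Hi Hj Ht) as (k & Hk & HPk & Hkt).
    rewrite (IH k Hk Hj Hkt), (unit_eigenvector_edge s f i k Hs Hf Hi Hk HPk).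
    simpl. ring.
Qed.

Lemma harmonic_const (f : nat -> R) (i j : nat) :
  eigenvector n P 1 f -> (i < n)%nat -> (j < n)%nat -> f j = f i.
Proof.
  intros Hf Hi Hj. destruct (Hirr i j Hi Hj) as [t Ht].
  rewrite (unit_eigenvector_path 1 f t i j) by (try assumption; ring).
  rewrite pow1. ring.
Qed.

(** A return path of length [t] gives [f i = (-1) ^ t * f i]. If [f i] were nonzero, every return
    time would be even. *)
Lemma aperiodic_no_eigenvalue_m1 (f : nat -> R) (i : nat) :
  aperiodic n P -> eigenvector n P (-1) f -> (i < n)%nat -> f i = 0.
Proof.
  intros Haper Hf Hi. apply NNPP. intros Hfi.
  enough (2 = 1)%nat by discriminate.
  apply (Haper i Hi); [lia|]. intros t _ Ht.
  assert (H : f i = (-1) ^ t * f i) by (apply unit_eigenvector_path; try assumption; ring).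
  destruct (Nat.Even_or_Odd t) as [[k ->]|[k ->]].
  - rewrite Nat.mul_comm. apply Nat.Div0.mod_mul.
  - rewrite Nat.add_1_r, pow_1_odd in H. lra.
Qed.

(** By stationarity [mean f = mean (P f) = l * mean f]. *)
Lemma mean_eigenvector (l : R) (f : nat -> R) :
  eigenvector n P l f -> l <> 1 -> mean n pi f = 0.
Proof.
  intros Hf Hl. pose proof (mean_op n P pi Hsto Hrev f) as H.
  rewrite (mean_ext n pi _ (fun i => l * f i + 0 * 0)), mean_lin in H
    by (intros; rewrite Hf by assumption; ring).
  nra.
Qed.

(** Conjugation by [sqrt pi] makes [P] symmetric, by detailed balance; dividing the eigenvectors by
    [sqrt pi] brings them back to [P]. *)
Lemma spectral_decomp_exists : exists lam f, spectral_decomp n P lam f.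
Proof.
  set (s := fun i => sqrt (pi i)).
  assert (Hs : forall i, (i < n)%nat -> 0 < s i) by (intros i Hi; apply sqrt_lt_R0; auto).
  assert (Hss : forall i, (i < n)%nat -> pi i = s i * s i).
  { intros i Hi. symmetry. apply sqrt_sqrt. left; auto. }
  destruct (@Spectral.symmetric_spectral_decomp n (fun i j => s i * P i j / s j))
    as (lam & v & Hv & Hind & Hsort).
  { intros i j Hi Hj. pose proof (Hs i Hi). pose proof (Hs j Hj).
    apply Rmult_eq_reg_r with (s i * s j);
      [|apply Rgt_not_eq; now apply Rmult_lt_0_compat].
    transitivity (s i * s i * P i j); [field; lra|].
    rewrite <- Hss, (Hrev i j Hi Hj), (Hss j Hj) by assumption. field. lra. }
  exists lam, (fun j i => v j i / s i). split; [|split; [|assumption]].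
  - intros j i Hj Hi. pose proof (Hs i Hi).
    apply Rmult_eq_reg_l with (s i); [|lra].
    transitivity (lam j * v j i); [|field; lra].
    rewrite <- (Hv j i Hj Hi), <- rsum_scal. apply rsum_ext. intros k Hk.
    pose proof (Hs k Hk). field. lra.
  - intros c Hc. apply Hind. intros i Hi. pose proof (Hs i Hi).
    apply Rmult_eq_reg_l with (/ s i); [|apply Rinv_neq_0_compat; lra].
    rewrite Rmult_0_r, <- (Hc i Hi), <- rsum_scal. apply rsum_ext. intros j Hj.
    field. lra.
Qed.

(** Existence of a decomposition ensures that the [epsilon] in [slem] selects a genuine value. *)
Lemma slem_spec : exists lam f, spectral_decomp n P lam f /\ slem n P = slem_of n lam.
Proof.
  unfold slem. apply epsilon_spec.
  destruct spectral_decomp_exists as (lam & f & H). now exists (slem_of n lam), lam, f.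
Qed.

(* Eigenvectors for distinct eigenvalues of a self-adjoint kernel are orthogonal, so the form
   [mean (g * op K g)] is the squared norm of the expansion weighted by [sqrt (w j)]. *)
Lemma nonneg_spectrum_form (K : nat -> nat -> R) (w : nat -> R) (f : nat -> nat -> R)
  (c g : nat -> R) :
  reversible n K pi ->
  (forall j, (j < n)%nat -> 0 <= w j) ->
  (forall j, (j < n)%nat -> eigenvector n K (w j) (f j)) ->
  (forall i, (i < n)%nat -> g i = rsum n (fun j => c j * f j i)) ->
  0 <= mean n pi (fun i => g i * op n K g i).
Proof.
  intros HK Hw Hf Hg.
  set (e := fun k j => mean n pi (fun i => f j i * f k i)).
  (* Within an eigenspace the [f j] may fail to be orthogonal, but there the weights agree; across
     eigenspaces [e k j] vanishes. *)
  assert (He : forall j k, (j < n)%nat -> (k < n)%nat ->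
    w k * e k j = sqrt (w j) * sqrt (w k) * e k j).
  { intros j k Hj Hk.
    destruct (Req_dec (w j) (w k)) as [->|Hne].
    - rewrite sqrt_sqrt by auto. reflexivity.
    - enough (e k j = 0) as -> by ring.
      pose proof (op_selfadjoint n K pi (f k) (f j) HK) as H.
      rewrite (mean_ext n pi _ (fun i => w k * (f j i * f k i) + 0 * 0)) in H
        by (intros; rewrite Hf by assumption; ring).
      rewrite (mean_ext n pi (fun i => f k i * _) (fun i => w j * (f j i * f k i) + 0 * 0)) in H
        by (intros; rewrite Hf by assumption; ring).
      rewrite !mean_lin in H. fold (e k j) in H. nra. }
  (* The square root of [K] applied to [g]. *)
  set (h := fun i => rsum n (fun j => (c j * sqrt (w j)) * f j i)).
  assert (Hexp : forall a b : nat -> R,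
    mean n pi (fun i => rsum n (fun j => a j * f j i) * rsum n (fun k => b k * f k i))
    = rsum n (fun k => b k * rsum n (fun j => a j * e k j))).
  { intros a b.
    rewrite (mean_ext n pi _
      (fun i => rsum n (fun k => b k * rsum n (fun j => a j * (f j i * f k i))))).
    - rewrite mean_rsum. apply rsum_ext. intros k _. f_equal. now rewrite mean_rsum.
    - intros i _. rewrite <- rsum_scal. apply rsum_ext. intros k _.
      rewrite (Rmult_comm (rsum n _)), Rmult_assoc. f_equal.
      rewrite <- rsum_scal. apply rsum_ext. intros j _. ring. }
  assert (Hop : forall i, (i < n)%nat -> op n K g i = rsum n (fun k => (c k * w k) * f k i)).
  { intros i Hi. rewrite (op_ext n K g (fun i => rsum n (fun j => c j * f j i)) i Hg), op_rsum.
    apply rsum_ext. intros k Hk. rewrite (Hf k Hk i Hi). ring. }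
  replace (mean n pi (fun i => g i * op n K g i)) with (mean n pi (fun i => h i * h i)).
  { apply mean_nonneg; [apply (proj1 Hpi)|]. intros i _. apply Rle_0_sqr. }
  rewrite (mean_ext n pi (fun i => g i * op n K g i)
    (fun i => rsum n (fun j => c j * f j i) * rsum n (fun k => (c k * w k) * f k i))).
  2:{ intros i Hi. rewrite Hop, Hg by assumption. reflexivity. }
  unfold h. rewrite !Hexp. apply rsum_ext. intros k Hk.
  rewrite <- !rsum_scal. apply rsum_ext. intros j Hj.
  transitivity (c k * c j * (sqrt (w j) * sqrt (w k) * e k j)); [ring|].
  rewrite <- (He j k Hj Hk). ring.
Qed.

(** * Spectral gap and Poincare inequality for a given decomposition *)

Section Decomposition.
Context (lam : nat -> R) (f : nat -> nat -> R) (Hdec : spectral_decomp n P lam f).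
Context (Hn : (0 < n)%nat).

Let Heig : forall j, (j < n)%nat -> eigenvector n P (lam j) (f j).
Proof. intros j Hj i Hi. now apply (proj1 Hdec). Qed.

Lemma decomp_span (g : nat -> R) :
  exists c : nat -> R, forall i, (i < n)%nat -> g i = rsum n (fun j => c j * f j i).
Proof. apply Spectral.independent_span, (proj1 (proj2 Hdec)). Qed.

Lemma decomp_sqr_le_1 (j : nat) : (j < n)%nat -> lam j ^ 2 <= 1.
Proof.
  intros Hj. destruct (independent_nonzero n f j (proj1 (proj2 Hdec)) Hj) as (i & Hi & Hfi).
  now apply eigenvalue_sqr_le_1 with (f j) i; [apply Heig|..].
Qed.

Lemma decomp_antitone (j : nat) : (j < n)%nat -> lam j <= lam 0%nat.
Proof.
  induction j as [|j IH]; intros Hj; [lra|].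
  apply Rle_trans with (lam j); [now apply Hdec|apply IH; lia].
Qed.

(** If 1 were not an eigenvalue, all [f j] would have mean zero, and so would the constant 1 in
    their span. Since [lam 0] is the largest and no eigenvalue exceeds 1, it equals 1. *)
Lemma decomp_top : lam 0%nat = 1.
Proof.
  destruct (classic (exists j, (j < n)%nat /\ lam j = 1)) as [(j & Hj & Hl)|Hno].
  - pose proof (decomp_antitone j Hj). pose proof (decomp_sqr_le_1 0 Hn). nra.
  - exfalso. destruct (decomp_span (fun _ => 1)) as [c Hc].
    pose proof (mean_const n pi Hpi 1) as H1.
    rewrite (mean_ext n pi _ (fun i => rsum n (fun j => c j * f j i)) Hc), mean_rsum in H1.
    rewrite (rsum_ext n _ (fun _ => 0)), rsum_0 in H1; [lra|].
    intros j Hj. rewrite (mean_eigenvector (lam j)); [ring|now apply Heig|].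
    intros Hl. apply Hno. now exists j.
Qed.

(** A second harmonic eigenvector would be constant like [f 0], and two constants are dependent. *)
Lemma decomp_simple (j : nat) : (0 < j)%nat -> (j < n)%nat -> lam j <> 1.
Proof.
  intros H0j Hj Hl.
  pose proof (Heig 0%nat Hn) as H0. rewrite decomp_top in H0.
  pose proof (Heig j Hj) as H1. rewrite Hl in H1.
  destruct (independent_nonzero n f j (proj1 (proj2 Hdec)) Hj) as (i & Hi & Hfi).
  set (c := fun k => if Nat.eqb k 0 then f j i else if Nat.eqb k j then - f 0%nat i else 0).
  apply Hfi. change (c 0%nat = 0). apply (proj1 (proj2 Hdec) c); [|assumption].
  intros k Hk.
  rewrite (rsum_ext n _ (fun l => (if Nat.eqb l 0 then f j i * f l k else 0)
    + (if Nat.eqb l j then - f 0%nat i * f l k else 0))).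
  - rewrite rsum_plus, (rsum_delta n 0), (rsum_delta n j) by assumption.
    rewrite (harmonic_const (f 0%nat) i k), (harmonic_const (f j) i k) by assumption. ring.
  - intros l _. unfold c. destruct (Nat.eqb_spec l 0), (Nat.eqb_spec l j); try lia; ring.
Qed.

Lemma slem_of_ge (j : nat) : (0 < j)%nat -> (j < n)%nat -> lam j <= slem_of n lam.
Proof.
  intros H0j Hj. apply Rle_trans with (Rabs (lam j)); [apply Rle_abs|].
  apply fold_Rmax_ge. apply (in_map (fun j => Rabs (lam j))), in_seq. lia.
Qed.

(** Past index 0, irreducibility excludes the eigenvalue 1 and aperiodicity excludes -1. *)
Lemma slem_of_lt_1 : aperiodic n P -> slem_of n lam < 1.
Proof.
  intros Haper. apply fold_Rmax_lt; [lra|]. intros b Hb.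
  apply in_map_iff in Hb. destruct Hb as (j & <- & Hj). apply in_seq in Hj.
  assert (Hjn : (j < n)%nat) by lia.
  pose proof (decomp_sqr_le_1 j Hjn). pose proof (decomp_simple j ltac:(lia) Hjn).
  assert (lam j <> -1).
  { intros Hl. destruct (independent_nonzero n f j (proj1 (proj2 Hdec)) Hjn) as (i & Hi & Hfi).
    apply Hfi, aperiodic_no_eigenvalue_m1; [assumption| |assumption].
    rewrite <- Hl. now apply Heig. }
  assert (lam j < 1) by (apply Rnot_le_lt; intros ?; assert (lam j = 1) by nra; tauto).
  assert (-1 < lam j) by (apply Rnot_le_lt; intros ?; assert (lam j = -1) by nra; tauto).
  now apply Rabs_def1.
Qed.

(* [K = I - P - gam * (I - 1 pi^T)] with [gam = 1 - slem_of n lam] annihilates constants and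
   multiplies [f j] by [slem_of n lam - lam j >= 0] for [j > 0]. *)
Lemma poincare_slem_of : poincare n P pi (1 - slem_of n lam).
Proof.
  intros g. set (gam := 1 - slem_of n lam).
  set (K := fun i j => (if Nat.eqb i j then 1 - gam else 0) - P i j + gam * pi j).
  assert (HK : forall h i, (i < n)%nat ->
    op n K h i = h i - op n P h i - gam * (h i - mean n pi h)).
  { intros h i Hi. unfold op, K, mean.
    rewrite (rsum_ext n _ (fun j => (if Nat.eqb j i then (1 - gam) * h j else 0)
      + ((- 1) * (P i j * h j) + gam * (pi j * h j)))).
    - rewrite !rsum_plus, rsum_delta, !rsum_scal by assumption. ring.
    - intros j _. rewrite (Nat.eqb_sym j i). destruct (Nat.eqb i j); ring. }
  assert (HKrev : reversible n K pi).
  { intros i j Hi Hj. unfold K. rewrite (Nat.eqb_sym j i).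
    pose proof (Hrev i j Hi Hj).
    destruct (Nat.eqb_spec i j) as [->|]; [ring|]. nra. }
  destruct (decomp_span g) as [c Hc].
  assert (H : 0 <= mean n pi (fun i => g i * op n K g i)).
  { apply (nonneg_spectrum_form K
      (fun j => if Nat.eqb j 0 then 0 else slem_of n lam - lam j) f c); try assumption.
    - intros j Hj. destruct (Nat.eqb_spec j 0); [lra|].
      pose proof (slem_of_ge j ltac:(lia) Hj). lra.
    - intros j Hj i Hi. rewrite HK, (Heig j Hj i Hi) by assumption.
      destruct (Nat.eqb_spec j 0) as [->|Hj0].
      + rewrite decomp_top.
        rewrite (mean_ext n pi (f 0%nat) (fun _ => f 0%nat i)), (mean_const n pi Hpi); [ring|].
        intros k Hk. apply harmonic_const; try assumption.
        pose proof (Heig 0%nat Hn) as H0. now rewrite decomp_top in H0.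
      + rewrite (mean_eigenvector (lam j)); [unfold gam; ring|now apply Heig|].
        apply decomp_simple; lia. }
  (* The quadratic form of [K] is the Dirichlet form minus [gam] times the variance. *)
  rewrite (mean_ext n pi _ (fun i => 1 * (g i * (g i - op n P g i))
    + (- gam) * (1 * g i ^ 2 + (- mean n pi g) * g i))) in H
    by (intros; rewrite HK by assumption; ring).
  rewrite !mean_lin in H. fold (dirichlet n P pi g) in H.
  rewrite (variance_eq n pi Hpi). nra.
Qed.
End Decomposition.

Lemma slem_gap :
  (0 < n)%nat -> aperiodic n P ->
  0 < 1 - slem n P /\ 1 - slem n P <= 1 /\ poincare n P pi (1 - slem n P).
Proof.
  intros Hn Haper. destruct slem_spec as (lam & f & Hdec & ->).
  pose proof (slem_of_lt_1 lam f Hdec Hn Haper).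
  pose proof (fold_Rmax_ge_init 0 (map (fun j => Rabs (lam j)) (seq 1 (n - 1)))) as H0.
  fold (slem_of n lam) in H0.
  split; [lra|]. split; [lra|]. now apply poincare_slem_of with f.
Qed.
End Eigen.

(** * Lazy chains and regular graphs *)

Lemma Rmax_inv_pi_set_nonneg (n x : nat) (pi : nat -> R) (A : nat -> bool) (r : R) :
  (forall i, (i < n)%nat -> 0 < pi i) -> (x < n)%nat -> A x = true ->
  0 <= Rmax r (/ pi_set n pi A).
Proof.
  intros Hpi Hx HA. apply Rle_trans with (2 := Rmax_r _ _).
  left. apply Rinv_0_lt_compat. now apply pi_set_pos with x.
Qed.

Lemma op_lazy (n : nat) (P : nat -> nat -> R) (f : nat -> R) (i : nat) :
  (i < n)%nat -> op n (lazy P) f i = (f i + op n P f i) / 2.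
Proof.
  intros Hi. unfold op, lazy.
  rewrite (rsum_ext n _ (fun j => / 2 * ((if Nat.eqb j i then f j else 0) + P i j * f j))).
  - rewrite rsum_scal, rsum_plus, rsum_delta by assumption. field.
  - intros j _. rewrite (Nat.eqb_sym j i). destruct (Nat.eqb i j); field.
Qed.

Lemma lazy_stochastic (n : nat) (P : nat -> nat -> R) :
  stochastic n P -> stochastic n (lazy P).
Proof.
  intros Hsto. split.
  - intros i j Hi Hj. pose proof (proj1 Hsto i j Hi Hj). unfold lazy.
    destruct (Nat.eqb i j); lra.
  - intros i Hi. rewrite (rsum_ext n _ (fun j => lazy P i j * 1)) by (intros; ring).
    fold (op n (lazy P) (fun _ => 1) i). rewrite op_lazy, op_const by assumption. field.
Qed.

Lemma lazy_reversible (n : nat) (P : nat -> nat -> R) (pi : nat -> R) :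
  reversible n P pi -> reversible n (lazy P) pi.
Proof.
  intros Hrev i j Hi Hj. pose proof (Hrev i j Hi Hj). unfold lazy.
  rewrite (Nat.eqb_sym j i). destruct (Nat.eqb_spec i j) as [->|]; lra.
Qed.

Lemma lazy_mpow_pos (n : nat) (P : nat -> nat -> R) (t i j : nat) :
  stochastic n P -> (i < n)%nat -> (j < n)%nat ->
  0 < mpow n P t i j -> 0 < mpow n (lazy P) t i j.
Proof.
  intros Hsto. revert i. induction t as [|t IH]; intros i Hi Hj Ht; [assumption|].
  destruct (mpow_S_pos n P t i j (proj1 Hsto) Hi Hj Ht) as (k & Hk & HPk & Hkt).
  pose proof (proj1 (lazy_stochastic n P Hsto)) as HL.
  apply Rlt_le_trans with (lazy P i k * mpow n (lazy P) t k j).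
  - apply Rmult_lt_0_compat; [|now apply IH].
    unfold lazy. destruct (Nat.eqb i k); lra.
  - simpl. apply (rsum_ge_term n k (fun k => lazy P i k * mpow n (lazy P) t k j)); [|assumption].
    intros l Hl. apply Rmult_le_pos; [now apply HL|now apply mpow_nonneg].
Qed.

Lemma lazy_irreducible (n : nat) (P : nat -> nat -> R) :
  stochastic n P -> irreducible n P -> irreducible n (lazy P).
Proof.
  intros Hsto Hirr i j Hi Hj. destruct (Hirr i j Hi Hj) as [t Ht].
  exists t. now apply lazy_mpow_pos.
Qed.

(** Every state holds with probability at least 1/2, so 1 is a return time. *)
Lemma lazy_aperiodic (n : nat) (P : nat -> nat -> R) :
  stochastic n P -> aperiodic n (lazy P).
Proof.
  intros Hsto i Hi d Hd H.
  assert (H1 : (1 mod d = 0)%nat).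
  { apply H; [lia|]. simpl.
    rewrite (rsum_ext n _ (fun k => if Nat.eqb k i then lazy P i k else 0)).
    - rewrite rsum_delta by assumption. unfold lazy. rewrite Nat.eqb_refl.
      pose proof (proj1 Hsto i i Hi Hi). lra.
    - intros k _. destruct (Nat.eqb k i); ring. }
  destruct (Nat.eq_dec d 1) as [|Hne]; [assumption|].
  rewrite Nat.mod_small in H1; lia.
Qed.

(** The lazy Dirichlet form is half that of [P], so even [2 * gam] would do. The estimates can then
    be applied to a periodic [P] directly. *)
Lemma poincare_lazy (n : nat) (P : nat -> nat -> R) (pi : nat -> R) (gam : R) :
  prob_measure n pi -> 0 <= gam -> poincare n (lazy P) pi gam -> poincare n P pi gam.
Proof.
  intros Hpi Hgam Hgap f. pose proof (Hgap f) as H.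
  pose proof (Rmult_le_pos _ _ Hgam (variance_nonneg n pi Hpi f)).
  unfold dirichlet in *.
  rewrite (mean_ext n pi _ (fun i => / 2 * (f i * (f i - op n P f i)) + 0 * 0)) in H
    by (intros; rewrite op_lazy by assumption; field).
  rewrite mean_lin in H. lra.
Qed.

(** * The uniform measure *)

Lemma rsum_indicator (n : nat) (b : nat -> bool) (c : R) :
  rsum n (fun i => if b i then c else 0) = INR (length (filter b (seq 0 n))) * c.
Proof.
  unfold rsum. induction (seq 0 n) as [|i l IH]; simpl; [ring|].
  rewrite IH. destruct (b i); simpl length; [rewrite S_INR|]; ring.
Qed.

Lemma uniform_prob_measure (N : nat) : (0 < N)%nat -> prob_measure N (uniform N).
Proof.
  intros HN. apply lt_0_INR in HN. split.
  - intros i _. left. now apply Rinv_0_lt_compat.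
  - unfold uniform. rewrite rsum_const. field. lra.
Qed.

Lemma pi_set_uniform (N : nat) (A : nat -> bool) :
  pi_set N (uniform N) A = INR (card_set N A) * / INR N.
Proof. apply (rsum_indicator N A (/ INR N)). Qed.

Lemma pi_min_uniform (N : nat) : pi_min N (uniform N) = / INR N.
Proof.
  unfold pi_min, uniform. induction (seq 0 N) as [|i l IH]; simpl; [reflexivity|].
  rewrite IH. apply Rmin_left, Rle_refl.
Qed.

Lemma pi_max_uniform (N : nat) : pi_max N (uniform N) = / INR N.
Proof.
  unfold pi_max, uniform. induction (seq 0 N) as [|i l IH]; simpl; [reflexivity|].
  rewrite IH. apply Rmax_left, Rle_refl.
Qed.

(** * Simple random walk on a connected regular graph *)

Section SimpleRandomWalk.
Context (N : nat) (adj : nat -> nat -> bool) (d : nat).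
Context (HN : (2 <= N)%nat) (Hsimple : simple_graph N adj).
Context (Hconn : connected N adj) (Hreg : regular N adj d).

Lemma degree_pos : 0 < INR d.
Proof.
  apply lt_0_INR. rewrite <- (Hreg 0%nat) by lia.
  (* A path from 0 to 1 has a first edge, so vertex 0 has a neighbour. *)
  pose proof (Hconn 0%nat 1%nat ltac:(lia) ltac:(lia)) as H. inversion H as [|x y z Hxy _]; subst.
  assert (Hin : In y (filter (adj 0%nat) (seq 0 N))).
  { apply filter_In. split; [|assumption]. apply in_seq.
    pose proof (proj2 (proj2 Hsimple) _ _ Hxy). lia. }
  unfold degree. destruct (filter (adj 0%nat) (seq 0 N)); [destruct Hin|simpl; lia].
Qed.

Lemma srw_stochastic : stochastic N (srw adj d).
Proof.
  pose proof degree_pos as Hd. split.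
  - intros i j _ _. unfold srw. destruct (adj i j); [|lra].
    left. now apply Rinv_0_lt_compat.
  - intros i Hi. unfold srw. rewrite rsum_indicator.
    fold (degree N adj i). rewrite (Hreg i Hi). field. lra.
Qed.

Lemma srw_reversible : reversible N (srw adj d) (uniform N).
Proof.
  intros i j Hi Hj. unfold srw, uniform. now rewrite (proj1 Hsimple i j Hi Hj).
Qed.

Lemma srw_irreducible : irreducible N (srw adj d).
Proof.
  intros i j Hi Hj. induction (Hconn i j Hi Hj) as [x|x y z Hxy Hyz IH].
  - exists 0%nat. simpl. rewrite Nat.eqb_refl. lra.
  - pose proof (proj2 (proj2 Hsimple) x y Hxy) as [_ Hy].
    destruct (IH Hy Hj) as [t Ht]. exists (S t). simpl.
    pose proof (proj1 srw_stochastic) as HP.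
    apply Rlt_le_trans with (srw adj d x y * mpow N (srw adj d) t y z).
    + apply Rmult_lt_0_compat; [|assumption]. unfold srw. rewrite Hxy.
      apply Rinv_0_lt_compat, degree_pos.
    + apply (rsum_ge_term N y (fun k => srw adj d x k * mpow N (srw adj d) t k z)); [|assumption].
      intros k Hk. apply Rmult_le_pos; [now apply HP|now apply mpow_nonneg].
Qed.

Lemma uniform_log_le (A : nat -> bool) (x : nat) :
  (x < N)%nat -> A x = true ->
  / INR N * Rmax (ln (2 * exp 1 / pi_min N (uniform N))) (/ pi_set N (uniform N) A)
  <= 4 * Rmax (/ INR (card_set N A)) (ln (INR N) / INR N).
Proof.
  intros Hx HA.
  assert (HN0 : 0 < INR N) by (apply lt_0_INR; lia).
  assert (Hu : forall i, (i < N)%nat -> 0 < uniform N i)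
    by (intros; now apply Rinv_0_lt_compat).
  pose proof (pi_set_pos N x (uniform N) A Hu Hx HA) as Hset.
  rewrite pi_set_uniform in *.
  assert (Hcard : 0 < INR (card_set N A)).
  { apply Rmult_lt_reg_r with (/ INR N); [now apply Rinv_0_lt_compat|lra]. }
  rewrite pi_min_uniform.
  set (M := Rmax (/ INR (card_set N A)) (ln (INR N) / INR N)).
  pose proof (Rmax_l (/ INR (card_set N A)) (ln (INR N) / INR N)) as HM1. fold M in HM1.
  pose proof (Rmax_r (/ INR (card_set N A)) (ln (INR N) / INR N)) as HM2. fold M in HM2.
  pose proof (Rinv_0_lt_compat _ Hcard).
  assert (Hln : ln (2 * exp 1 / / INR N) = ln 2 + 1 + ln (INR N)).
  { pose proof (exp_pos 1). unfold Rdiv. rewrite Rinv_inv.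
    rewrite !ln_mult, ln_exp; lra. }
  assert (Hln2 : ln 2 <= ln (INR N)).
  { assert (H2 : 2 <= INR N) by (change 2 with (INR 2); now apply le_INR).
    destruct H2 as [H2|<-]; [left; apply ln_increasing; lra|lra]. }
  pose proof ln_lt_2.
  apply Rmult_le_reg_l with (INR N); [assumption|].
  rewrite <- Rmult_assoc, Rinv_r, Rmult_1_l by lra.
  apply Rmax_lub.
  (* Here [ln 2 <= ln N] and [1 < 2 * ln 2 <= 2 * ln N], whence the constant 4. *)
  - rewrite Hln. apply Rle_trans with (4 * ln (INR N)); [lra|].
    replace (4 * ln (INR N)) with (INR N * (4 * (ln (INR N) / INR N))) by (field; lra).
    apply Rmult_le_compat_l; lra.
  - replace (/ (INR (card_set N A) * / INR N)) with (INR N * / INR (card_set N A))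
      by (field; lra).
    apply Rmult_le_compat_l; lra.
Qed.

Lemma srw_bound (gam : R) (A : nat -> bool) (x : nat) :
  0 < gam -> gam <= 1 -> poincare N (srw adj d) (uniform N) gam ->
  (x < N)%nat -> A x = true ->
  let M := Rmax (/ INR (card_set N A)) (ln (INR N) / INR N) in
  hstat N (srw adj d) (uniform N) A x <= 20 / (uP N (srw adj d) * gam) * M /\
  20 / (uP N (srw adj d) * gam) * M <= 40 / gam ^ 2 * M.
Proof.
  intros Hg0 Hg1 Hgap Hx HA M.
  assert (HN0 : 0 < INR N) by (apply lt_0_INR; lia).
  assert (Hu : forall i, (i < N)%nat -> 0 < uniform N i)
    by (intros; now apply Rinv_0_lt_compat).
  assert (Hpi : prob_measure N (uniform N)) by (apply uniform_prob_measure; lia).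
  pose proof (uniform_log_le A x Hx HA) as HL. fold M in HL.
  set (L := Rmax (ln (2 * exp 1 / pi_min N (uniform N))) (/ pi_set N (uniform N) A)) in HL.
  assert (HM : 0 <= M).
  { assert (HL0 : 0 <= L) by now apply Rmax_inv_pi_set_nonneg with x.
    pose proof (Rmult_le_pos _ _ (Rlt_le _ _ (Hu x Hx)) HL0) as H. unfold uniform in H. lra. }
  destruct (uP_bounds N _ _ gam HN srw_stochastic Hpi srw_reversible Hu Hg0 Hgap) as [HuL Hu1].
  rewrite pi_min_uniform, pi_max_uniform in HuL.
  pose proof (Rinv_0_lt_compat _ HN0) as HiN.
  assert (Hu0 : 0 < uP N (srw adj d)).
  { apply Rlt_le_trans with (2 := HuL).
    apply Rdiv_lt_0_compat; [now apply Rmult_lt_0_compat|lra]. }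
  split.
  - apply Rle_trans with (20 / gam * M); [|apply escape_factor_le; lra].
    apply Rle_trans with (1 := hstat_le N _ _ gam A x srw_stochastic Hpi srw_reversible Hu
                                 Hg0 Hg1 Hgap Hx HA).
    fold L. rewrite Rmult_assoc. fold (uniform N x) in HL.
    replace (20 / gam * M) with (5 / gam * (4 * M)) by (field; lra).
    apply Rmult_le_compat_l; [|exact HL].
    left. apply Rdiv_lt_0_compat; lra.
  (* For the uniform measure the ratio of [pi_max] to [pi_min] is 1. *)
  - replace (40 / gam ^ 2 * M) with (2 * 20 * / INR N / (gam ^ 2 * / INR N) * M)
      by (field; lra).
    apply inv_escape_factor_le; lra.
Qed.
End SimpleRandomWalk.

Theorem mainTheorem5 :
  exists C C' : R, 0 < C /\ 0 < C' /\
  (* general reversible chains *)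
  (forall (n : nat) (P : nat -> nat -> R) (pi : nat -> R),
     (2 <= n)%nat -> stochastic n P -> irreducible n P -> aperiodic n P ->
     prob_measure n pi -> reversible n P pi ->
     forall (A : nat -> bool) (x : nat),
       (exists y, (y < n)%nat /\ A y = true) ->
       (x < n)%nat -> A x = true ->
       let lam := slem n P in
       let L := Rmax (ln (2 * exp 1 / pi_min n pi)) (/ pi_set n pi A) in
       hstat n P pi A x <= C / (uP n P * (1 - lam)) * pi x * L /\
       C / (uP n P * (1 - lam)) * pi x * L
         <= C' * pi_max n pi / ((1 - lam) ^ 2 * pi_min n pi) * pi x * L) /\
  (* simple random walk on a finite connected regular graph *)
  (forall (N : nat) (adj : nat -> nat -> bool) (d : nat),
     (2 <= N)%nat -> simple_graph N adj -> connected N adj -> regular N adj d ->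
     forall (A : nat -> bool) (x : nat),
       (exists y, (y < N)%nat /\ A y = true) ->
       (x < N)%nat -> A x = true ->
       let P := srw adj d in
       let lam := if excluded_middle_informative (aperiodic N P)
                  then slem N P else slem N (lazy P) in
       let M := Rmax (/ INR (card_set N A)) (ln (INR N) / INR N) in
       hstat N P (uniform N) A x <= C / (uP N P * (1 - lam)) * M /\
       C / (uP N P * (1 - lam)) * M <= C' / (1 - lam) ^ 2 * M).
Proof.
  (* The constant 20 is 5 from [hstat_le] times 4 from [uniform_log_le]; 40 doubles it because of
     the 2 in the lower bound for [uP]. *)
  exists 20, 40. split; [lra|]. split; [lra|]. split.
  - intros n P pi Hn Hsto Hirr Haper Hpi Hrev A x _ Hx HA lam L.
    pose proof (irreducible_pi_pos n P pi Hsto Hpi Hrev Hirr) as Hpos.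
    assert (Hn0 : (0 < n)%nat) by lia.
    destruct (slem_gap n P pi Hsto Hpi Hrev Hirr Hn0 Haper) as (Hg0 & Hg1 & Hgap).
    fold lam in Hg0, Hg1, Hgap.
    destruct (uP_bounds n P pi _ Hn Hsto Hpi Hrev Hpos Hg0 Hgap) as [HuL Hu1].
    assert (Hp : 0 < pi_min n pi) by now apply pi_min_pos.
    assert (Hq : 0 < pi_max n pi).
    { apply Rlt_le_trans with (pi x); [auto|now apply pi_max_ge]. }
    assert (Hu0 : 0 < uP n P).
    { apply Rlt_le_trans with (2 := HuL).
      apply Rdiv_lt_0_compat; [now apply Rmult_lt_0_compat|lra]. }
    assert (HK : 0 <= pi x * L).
    { apply Rmult_le_pos; [left; auto|]. now apply Rmax_inv_pi_set_nonneg with x. }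
    rewrite !(Rmult_assoc _ (pi x) L). split.
    + apply Rle_trans with (5 / (1 - lam) * (pi x * L)).
      { rewrite <- Rmult_assoc. now apply hstat_le. }
      apply Rle_trans with (20 / (1 - lam) * (pi x * L)).
      * apply Rmult_le_compat_r; [assumption|]. apply Rmult_le_compat_r; [|lra].
        left. now apply Rinv_0_lt_compat.
      * apply escape_factor_le; lra.
    + replace 40 with (2 * 20) by ring. apply inv_escape_factor_le; lra.
  - intros N adj d HN Hsimple Hconn Hreg A x _ Hx HA P lam M.
    pose proof (srw_stochastic N adj d HN Hsimple Hconn Hreg) as Hsto.
    pose proof (srw_reversible N adj d Hsimple) as Hrev.
    pose proof (srw_irreducible N adj d HN Hsimple Hconn Hreg) as Hirr.
    assert (HN0 : (0 < N)%nat) by lia.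
    pose proof (uniform_prob_measure N HN0) as Hpi.
    assert (H : 0 < 1 - lam /\ 1 - lam <= 1 /\ poincare N P (uniform N) (1 - lam)).
    { unfold lam. destruct (excluded_middle_informative (aperiodic N P)) as [Haper|_].
      - now apply slem_gap.
      (* In the periodic case the gap is that of the lazy walk, whose Poincare inequality passes to
         [P] with the same constant. *)
      - destruct (slem_gap N (lazy P) (uniform N)) as (H0 & H1 & H2);
          [now apply lazy_stochastic|assumption|now apply lazy_reversible
          |now apply lazy_irreducible|assumption|now apply lazy_aperiodic|].
        split; [assumption|]. split; [assumption|].
        apply poincare_lazy; [assumption|lra|assumption]. }
    destruct H as (Hg0 & Hg1 & Hgap). now apply srw_bound.
Qed.
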